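(* Consider the root system $A_1$ at $t=q$. Let $r,s$ be relatively prime integers, let $b\ge 0$ be an integer, and let $\tilde\gamma_{r,s}$ be a word in $\tau_\pm^{\pm1}$ whose matrix (under $\tau_+\mapsto\left(\begin{smallmatrix}1&1\\0&1\end{smallmatrix}\right)$, $\tau_-\mapsto\left(\begin{smallmatrix}1&0\\1&1\end{smallmatrix}\right)$) has first column $(r,s)^{tr}$. Set $J^{\#}_{r,s}(b;q,q)=\{\tilde\gamma_{r,s}(P_b)\}$. Then $$J^{\#}_{r,s}(b;q,q)=\sum_{p=-b/2}^{b/2}\frac{q^{-rsp^2}}{q^{-1/2}-q^{1/2}}\Bigl(q^{(r+s)p-1/2}-q^{(r-s)p+1/2}\Bigr),$$ where $p$ runs from $-b/2$ to $b/2$ with step $1$. In particular, for $b=1$, $$J^{\#}_{r,s}(1;q,q)=\frac{q^{-rs/4-(r+s)/2}}{1-q}\bigl(1-q^{r+1}-q^{s+1}+q^{r+s}\bigr),$$ and, for $r,s\ge0$, the reduced invariant $J^{\#}_{r,s}(1;q,q)/P_1(q^{-1/2})$, divided by its lowest monomial in $q$, equals $$\frac{1-q^{r+1}-q^{s+1}+q^{r+s}}{1-q^2}.$$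
   Context: The double affine Hecke algebra $\mathcal{H}$ of type $A_1$ (with parameters $q,t$) is generated by invertible $X,Y,T$ over $\mathbb{Q}(q^{1/4},t^{1/2})$ with relations $(T-t^{1/2})(T+t^{-1/2})=0$, $TXT=X^{-1}$, $T^{-1}YT^{-1}=Y^{-1}$, $Y^{-1}X^{-1}YXT^2q^{1/2}=1$. Put $\pi=YT^{-1}$ (so $\pi^2=1$). Here everything is specialized to $t=q$. Polynomial representation on Laurent polynomials in $X$: $X$ acts by multiplication, $T=t^{1/2}s+\frac{t^{1/2}-t^{-1/2}}{X^2-1}(s-1)$ with $s(X)=X^{-1}$, $\pi(f)(X)=f(q^{1/2}X^{-1})$, $Y=\pi T$. Evaluation functional: $\{H\}=H(1)|_{X\mapsto t^{-1/2}}$ for $H\in\mathcal{H}$, where $H(1)$ is the action of $H$ on $1$ in the polynomial representation; at $t=q$ one sets $X\mapsto q^{-1/2}$. Automorphisms of $\mathcal{H}$: $\tau_+(X)=X$, $\tau_+(T)=T$, $\tau_+(Y)=q^{-1/4}XY$; $\tau_-(Y)=Y$, $\tau_-(T)=T$, $\tau_-(X)=q^{1/4}YX$. At $t=q$ the symmetric Macdonald polynomials are the characters $P_b=\frac{X^{b+1}-X^{-b-1}}{X-X^{-1}}=X^b+X^{b-2}+\dots+X^{-b}$, $b\ge0$; $P_b(q^{-1/2})$ denotes the value at $X=q^{-1/2}$. *)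

(* Defs.v *)
From HB Require Import structures.
From mathcomp Require Import all_boot all_order all_algebra.
From mathcomp Require Import ring boolp.

Set Implicit Arguments.
Unset Strict Implicit.
Unset Printing Implicit Defensive.

Import Order.TTheory GRing.Theory Num.Theory.
Local Open Scope ring_scope.
Local Open Scope quotient_scope.

Local Notation "p %:F" := (FracField.tofrac p).

Lemma div_cross (L : fieldType) (a b c d : L) :
  b != 0 -> d != 0 -> a / b = c / d -> a * d = c * b.
Proof. by move=> b0 d0 /eqP; rewrite eqr_div // => /eqP. Qed.

Section Laurent.
Variable F : fieldType.
Local Notation FX := {fraction {poly F}}.

Definition cstX (c : F) : FX := (c%:P)%:F.
Definition varX : FX := ('X : {poly F})%:F.

Lemma varX_neq0 : varX != 0.
Proof. by rewrite tofrac_eq0 polyX_eq0. Qed.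

Lemma varX_sqrB1_neq0 : varX ^+ 2 - 1 != 0.
Proof.
rewrite -tofracXn -tofrac1 -tofracB tofrac_eq0 -size_poly_gt0.
by rewrite size_XnsubC.
Qed.

Lemma cstX_zmod_morphism : zmod_morphism cstX.
Proof. by move=> a b; rewrite /cstX polyCB tofracB. Qed.
Lemma cstX_monoid_morphism : monoid_morphism cstX.
Proof.
split=> [|a b]; rewrite /cstX.
  by rewrite polyC1 tofrac1.
by rewrite polyCM tofracM.
Qed.
HB.instance Definition _ := GRing.isZmodMorphism.Build F FX cstX cstX_zmod_morphism.
HB.instance Definition _ := GRing.isMonoidMorphism.Build F FX cstX cstX_monoid_morphism.

Definition is_laurent : {pred FX} :=
  [pred f | `[< exists (p : {poly F}) n, f = p%:F / varX ^+ n >]].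

Lemma is_laurentP f :
  reflect (exists (p : {poly F}) n, f = p%:F / varX ^+ n) (f \in is_laurent).
Proof. exact: asboolP. Qed.

Lemma laurent_subring_closed : subring_closed is_laurent.
Proof.
split.
- by apply/is_laurentP; exists 1, 0; rewrite tofrac1 expr0 divr1.
- move=> _ _ /is_laurentP[p [n ->]] /is_laurentP[r [m ->]]; apply/is_laurentP.
  exists (p * 'X^m - r * 'X^n), (n + m)%N.
  rewrite tofracB !tofracM !tofracXn -/varX exprD -mulNr addf_div ?mulNr //.
    by rewrite expf_neq0 // varX_neq0.
  by rewrite expf_neq0 // varX_neq0.
- move=> _ _ /is_laurentP[p [n ->]] /is_laurentP[r [m ->]]; apply/is_laurentP.
  by exists (p * r), (n + m)%N; rewrite tofracM exprD mulf_div.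
Qed.
HB.instance Definition _ := GRing.isSubringClosed.Build FX is_laurent
  laurent_subring_closed.

(* Laurent polynomials in X over F, as a subring of F(X). *)
Record laurent := Laurent { lval :> FX; _ : lval \in is_laurent }.
HB.instance Definition _ := [isSub for lval].
HB.instance Definition _ := [Choice of laurent by <:].
HB.instance Definition _ := [SubChoice_isSubComNzRing of laurent by <:].

Lemma lval_inj : injective lval. Proof. exact: val_inj. Qed.
Lemma lval1 : lval 1 = 1. Proof. exact: (rmorph1 val). Qed.
Lemma lvalD : {morph lval : f g / f + g}. Proof. exact: (rmorphD val). Qed.
Lemma lvalN : {morph lval : f / - f}. Proof. exact: (rmorphN val). Qed.
Lemma lvalB : {morph lval : f g / f - g}. Proof. exact: (rmorphB val). Qed.
Lemma lvalM : {morph lval : f g / f * g}. Proof. exact: (rmorphM val). Qed.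
Lemma lvalXn n : {morph lval : f / f ^+ n}. Proof. exact: (rmorphXn val). Qed.

Lemma cstX_laurent c : cstX c \in is_laurent.
Proof. by apply/is_laurentP; exists c%:P, 0; rewrite expr0 divr1. Qed.
Lemma varX_laurent : varX \in is_laurent.
Proof. by apply/is_laurentP; exists 'X, 0; rewrite expr0 divr1. Qed.
Lemma varXV_laurent : varX^-1 \in is_laurent.
Proof. by apply/is_laurentP; exists 1, 1; rewrite tofrac1 expr1 div1r. Qed.

Definition lcst c : laurent := Laurent (cstX_laurent c).
Definition lX : laurent := Laurent varX_laurent.
Definition lXV : laurent := Laurent varXV_laurent.

Definition lscale (c : F) (f : laurent) := lcst c * f.
Lemma lscaleA a b f : lscale a (lscale b f) = lscale (a * b) f.
Proof.
by rewrite /lscale mulrA; congr (_ * _); apply: lval_inj; rewrite /= rmorphM.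
Qed.
Lemma lscale1 : left_id 1 lscale.
Proof.
move=> f; rewrite /lscale -[RHS]mul1r; congr (_ * _); apply: lval_inj.
by rewrite /= rmorph1.
Qed.
Lemma lscaleDr : right_distributive lscale +%R.
Proof. by move=> a f g; rewrite /lscale mulrDr. Qed.
Lemma lscaleDl f : {morph lscale^~ f : a b / a + b}.
Proof.
move=> a b; rewrite /lscale -mulrDl; congr (_ * _); apply: lval_inj.
by rewrite /= rmorphD.
Qed.
HB.instance Definition _ :=
  GRing.Zmodule_isLmodule.Build F laurent lscaleA lscale1 lscaleDr lscaleDl.
Lemma lscaleAl c (f g : laurent) : c *: (f * g) = (c *: f) * g.
Proof. by rewrite /GRing.scale /= /lscale mulrA. Qed.
HB.instance Definition _ := GRing.Lmodule_isLalgebra.Build F laurent lscaleAl.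
HB.instance Definition _ := GRing.Lalgebra_isComAlgebra.Build F laurent.

Lemma lval_scale c (f : laurent) : lval (c *: f) = cstX c * lval f.
Proof. by []. Qed.

Lemma lXXV : lX * lXV = 1.
Proof. by apply: lval_inj; rewrite /= divff ?varX_neq0. Qed.
Lemma lXVX : lXV * lX = 1.
Proof. by rewrite mulrC lXXV. Qed.

Definition lpoly (p : {poly F}) : laurent := (map_poly (in_alg laurent) p).[lX].

Lemma lval_lpoly p : lval (lpoly p) = p%:F.
Proof.
rewrite /lpoly horner_coef size_map_poly -[LHS]/(val _) rmorph_sum.
rewrite -[p in RHS]coefK poly_def (rmorph_sum (@FracField.tofrac _)).
apply: eq_bigr => i _; rewrite rmorphM rmorphXn coef_map /= -mul_polyC tofracM tofracXn.
by rewrite mulr1.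
Qed.

Lemma laurentP (f : laurent) :
  exists pn : {poly F} * nat, f = lpoly pn.1 * lXV ^+ pn.2.
Proof.
case: f => f fL; have /is_laurentP[p [n fE]] := fL; exists (p, n); apply: lval_inj.
by rewrite lvalM lvalXn lval_lpoly /= fE exprVn.
Qed.

(* The value f(u) of a Laurent polynomial f at an element u, with inverse ui,
   of a commutative F-algebra. *)
Definition lsubst (A : comAlgType F) (u ui : A) (f : laurent) : A :=
  let pn := projT1 (cid (laurentP f)) in
  (map_poly (in_alg A) pn.1).[u] * ui ^+ pn.2.

Section LSubst.
Variables (A : comAlgType F) (u ui : A).
Hypothesis uui : u * ui = 1.
Local Notation "p ^A" := (map_poly (in_alg A) p) (at level 2).

Lemma lsubstE p n : lsubst u ui (lpoly p * lXV ^+ n) = p^A.[u] * ui ^+ n.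
Proof.
rewrite /lsubst; case: cid => -[r m] /= E.
have {E} E : p * 'X^m = r * 'X^n.
  apply/eqP; rewrite -tofrac_eq !tofracM !tofracXn -/varX; apply/eqP.
  have := congr1 lval E; rewrite !lvalM !lvalXn /= !lval_lpoly.
  rewrite !exprVn => {}E.
  have Xm : varX ^+ m != 0 by rewrite expf_neq0 ?varX_neq0.
  have Xn : varX ^+ n != 0 by rewrite expf_neq0 ?varX_neq0.
  exact: div_cross Xn Xm E.
have /(congr1 (fun z => z.[u])) := congr1 (map_poly (in_alg A)) E.
rewrite !rmorphM /= !map_polyXn !hornerM !hornerXn => {}E.
have k1 k : u ^+ k * ui ^+ k = 1 by rewrite -exprMn uui expr1n.
rewrite -[LHS]mulr1 -(k1 n) -[RHS]mulr1 -(k1 m) mulrACA -E.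
by rewrite [ui ^+ m * _]mulrC mulrACA.
Qed.

Lemma lsubst_poly p : lsubst u ui (lpoly p) = p^A.[u].
Proof. by have := lsubstE p 0; rewrite !expr0 !mulr1. Qed.

Lemma lpoly_is_rmorph p q : (lpoly (p - q) = lpoly p - lpoly q) *
  (lpoly (p * q) = lpoly p * lpoly q).
Proof. by rewrite /lpoly rmorphB rmorphM hornerD hornerN hornerM. Qed.

Lemma lpolyX n : lpoly 'X^n = lX ^+ n.
Proof. by rewrite /lpoly map_polyXn hornerXn. Qed.

Lemma lsubst_X : lsubst u ui lX = u.
Proof. by rewrite -[lX]expr1 -lpolyX lsubst_poly map_polyXn hornerXn. Qed.

Lemma lpolyC c : lpoly c%:P = c%:A.
Proof. by rewrite /lpoly map_polyC hornerC. Qed.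

Lemma lsubst_XV : lsubst u ui lXV = ui.
Proof.
have := lsubstE 1%:P 1.
by rewrite !expr1 lpolyC scale1r mul1r map_polyC hornerC /= scale1r mul1r.
Qed.

Lemma lsubst_zmod_morphism : zmod_morphism (lsubst u ui).
Proof.
move=> f g; have [[p n] /= ->] := laurentP f; have [[r m] /= ->] := laurentP g.
have k1 k : u ^+ k * ui ^+ k = 1 by rewrite -exprMn uui expr1n.
have k2 k : lX ^+ k * lXV ^+ k = 1 by rewrite -exprMn lXXV expr1n.
transitivity (lsubst u ui (lpoly (p * 'X^m - r * 'X^n) * lXV ^+ (n + m))).
  congr lsubst; rewrite !lpoly_is_rmorph !lpolyX exprD mulrBl.
  rewrite mulrACA k2 mulr1.
  by rewrite [lXV ^+ n * _]mulrC mulrACA k2 mulr1.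
rewrite !lsubstE rmorphB !rmorphM /= !map_polyXn hornerD hornerN !hornerM !hornerXn exprD mulrBl.
rewrite mulrACA k1 mulr1.
by rewrite [ui ^+ n * _]mulrC mulrACA k1 mulr1.
Qed.

Lemma lsubst_monoid_morphism : monoid_morphism (lsubst u ui).
Proof.
split=> [|f g].
  by rewrite -[1 in LHS]scale1r -lpolyC lsubst_poly map_polyC hornerC /= scale1r.
have [[p n] /= ->] := laurentP f; have [[r m] /= ->] := laurentP g.
rewrite mulrACA -lpoly_is_rmorph -exprD !lsubstE rmorphM hornerM exprD.
by rewrite mulrACA.
Qed.

Lemma lsubst_scale c f : lsubst u ui (c *: f) = c *: lsubst u ui f.
Proof.
rewrite -mulr_algl lsubst_monoid_morphism.2 -lpolyC lsubst_poly map_polyC hornerC.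
by rewrite /= mulr_algl.
Qed.

Lemma lsubst_linear : linear (lsubst u ui).
Proof.
move=> c f g; have B := lsubst_zmod_morphism.
have h0 : lsubst u ui 0 = 0 by rewrite -[0 in LHS](subrr 0) B subrr.
have N h : lsubst u ui (- h) = - lsubst u ui h by rewrite -[- h]add0r B h0 add0r.
by rewrite -[g in LHS]opprK B N opprK lsubst_scale.
Qed.
End LSubst.

Lemma laurent_ind (P : laurent -> Prop) :
    (forall f g, P f -> P g -> P (f + g)) -> (forall c f, P f -> P (c *: f)) ->
    (forall n, P (lX ^+ n)) -> (forall n, P (lXV ^+ n)) ->
  forall f, P f.
Proof.
move=> PD PZ PX PV f; have [[p n] /= ->] := laurentP f.
have P0 : P 0 by rewrite -(scale0r (lX ^+ 0)); apply: PZ.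
rewrite /lpoly horner_coef mulr_suml; elim/big_ind: _ => // i _.
rewrite coef_map /= mulr_algl -scalerAl; apply: PZ.
have k2 k : lX ^+ k * lXV ^+ k = 1 by rewrite -exprMn lXXV expr1n.
have [le_ni | /ltnW le_in] := leqP n i.
  by rewrite -(subnK le_ni) exprD -mulrA k2 mulr1.
by rewrite -(subnK le_in) addnC exprD mulrA k2 mul1r.
Qed.

(* s(f)(X) = f(X^{-1}) *)
Definition linv : laurent -> laurent := lsubst lXV lX.
HB.instance Definition _ := GRing.isZmodMorphism.Build laurent laurent linv
  (lsubst_zmod_morphism lXVX).
HB.instance Definition _ := GRing.isMonoidMorphism.Build laurent laurent linv
  (lsubst_monoid_morphism lXVX).
HB.instance Definition _ := GRing.isScalable.Build F laurent laurent *:%R linv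
  (lsubst_scale lXVX).

Lemma linvD : {morph linv : f g / f + g}. Proof. exact: (rmorphD linv). Qed.
Lemma linvB : {morph linv : f g / f - g}. Proof. exact: (rmorphB linv). Qed.
Lemma linvM : {morph linv : f g / f * g}. Proof. exact: (rmorphM linv). Qed.
Lemma linv1 : linv 1 = 1. Proof. exact: (rmorph1 linv). Qed.
Lemma linvXn n : {morph linv : f / f ^+ n}. Proof. exact: (rmorphXn linv). Qed.
Lemma linvZ c f : linv (c *: f) = c *: linv f. Proof. exact: (lsubst_scale lXVX). Qed.
Lemma linvX : linv lX = lXV. Proof. exact: lsubst_X lXVX. Qed.
Lemma linvXV : linv lXV = lX. Proof. exact: lsubst_XV lXVX. Qed.
Lemma linvK : involutive linv.
Proof.
move=> f; elim/laurent_ind: f => [f g Ef Eg|c f Ef|n|n].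
- by rewrite !raddfD /= Ef Eg.
- by rewrite !linearZ /= Ef.
- by rewrite !rmorphXn /= linvX linvXV.
- by rewrite !rmorphXn /= linvXV linvX.
Qed.

Lemma ldiff_subproof f : (lval (linv f) - lval f) / (varX ^+ 2 - 1) \in is_laurent.
Proof.
have XV : lX - lXV = lXV * (lX ^+ 2 - 1).
  by rewrite mulrBr expr2 mulrA lXVX mul1r mulr1.
have key n : (lval (lX ^+ n - lXV ^+ n)) / (varX ^+ 2 - 1) \in is_laurent.
  rewrite subrXX XV !lvalM lvalB lvalXn lval1 /=.
  rewrite mulrAC mulfK ?varX_sqrB1_neq0 // -[varX^-1]/(lval lXV) -lvalM.
  exact: valP.
elim/laurent_ind: f => [f g Ef Eg|c f Ef|n|n].
- by rewrite raddfD !lvalD opprD addrACA mulrDl rpredD.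
- rewrite linearZ !lval_scale -mulrBr -mulrA.
  by rewrite rpredM ?cstX_laurent.
- rewrite rmorphXn /= linvX -lvalB -opprB lvalN mulNr rpredN; exact: key.
- rewrite rmorphXn /= linvXV -lvalB; exact: key.
Qed.

(* (s(f) - f) / (X^2 - 1) *)
Definition ldiff f : laurent := Laurent (ldiff_subproof f).

Lemma ldiffE f : (lX ^+ 2 - 1) * ldiff f = linv f - f.
Proof.
apply: lval_inj; rewrite lvalM !lvalB lvalXn lval1 /= mulrC.
by rewrite divfK // varX_sqrB1_neq0.
Qed.
End Laurent.

(* The value f(u), for u != 0. *)
Definition leval (F : fieldType) (u : F) (f : laurent F) : F :=
  lsubst (u : F^o) (u^-1 : F^o) f.

Definition Tform (L : fieldType) (t x a b : L) : L :=
  t * b + (t - t^-1) * ((b - a) / (x ^+ 2 - 1)).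

Section Tform.
Variables (L : fieldType) (t x : L).
Hypotheses (t0 : t != 0) (x0 : x != 0) (x1 : x ^+ 2 - 1 != 0).

Let x1' : 1 + -1 * x ^+ 2 != 0.
Proof. by rewrite mulN1r -oppr_eq0 opprB. Qed.

Lemma Tform_denV : x^-1 ^+ 2 - 1 != 0.
Proof.
have -> : x^-1 ^+ 2 - 1 = - (x ^+ 2 - 1) / x ^+ 2 by field.
by rewrite mulf_neq0 ?invr_neq0 ?expf_neq0 ?oppr_eq0.
Qed.

Lemma TformD c a a' b b' :
  Tform t x (c * a + a') (c * b + b') = c * Tform t x a b + Tform t x a' b'.
Proof. by rewrite /Tform; field; rewrite t0 x1. Qed.

Lemma Tform_Hecke a b :
  Tform t x (Tform t x a b) (Tform t x^-1 b a) = (t - t^-1) * Tform t x a b + a.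
Proof. by rewrite /Tform; field; rewrite t0 x1 x0 x1'. Qed.

Lemma Tform_TXT a b :
  Tform t x (x * Tform t x a b) (x^-1 * Tform t x^-1 b a) = x^-1 * a.
Proof. by rewrite /Tform; field; rewrite t0 x1 x0 x1'. Qed.
End Tform.

Section LinearEndo.
Variables (F : fieldType).
Local Notation V := (laurent F).

(* F-linear endomorphisms of the Laurent polynomials; the product is
   composition. *)
Record lend := Lend { lend_fun :> V -> V; lend_linear : linear lend_fun }.
HB.instance Definition _ := gen_eqMixin lend.
HB.instance Definition _ := gen_choiceMixin lend.

Lemma lendP (f g : lend) : f =1 g -> f = g.
Proof.
case: f g => [f fl] [g gl] /= /funext E; rewrite E in fl *.
by congr Lend; apply: Prop_irrelevance.
Qed.

Lemma lend0_subproof : linear (fun _ : V => 0 : V).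
Proof. by move=> c f g; rewrite scaler0 addr0. Qed.
Lemma lend1_subproof : linear (@id V).
Proof. by []. Qed.
Lemma lendD_subproof (a b : lend) : linear (fun f => a f + b f).
Proof. by move=> c f g; rewrite !lend_linear scalerDr addrACA. Qed.
Lemma lendN_subproof (a : lend) : linear (fun f => - a f).
Proof. by move=> c f g; rewrite lend_linear opprD scalerN. Qed.
Lemma lendM_subproof (a b : lend) : linear (fun f => a (b f)).
Proof. by move=> c f g; rewrite !lend_linear. Qed.
Lemma lendZ_subproof k (a : lend) : linear (fun f => k *: a f).
Proof. by move=> c f g; rewrite lend_linear scalerDr !scalerA mulrC. Qed.

Definition lend0 := Lend lend0_subproof.
Definition lend1 := Lend lend1_subproof.
Definition lendD a b := Lend (lendD_subproof a b).
Definition lendN a := Lend (lendN_subproof a).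
Definition lendM a b := Lend (lendM_subproof a b).
Definition lendZ k a := Lend (lendZ_subproof k a).

Lemma lend_add (a : lend) f g : a (f + g) = a f + a g.
Proof. by have := lend_linear a 1 f g; rewrite !scale1r. Qed.

Lemma lend_addrA : associative lendD.
Proof. by move=> a b c; apply: lendP => f; apply: addrA. Qed.
Lemma lend_addrC : commutative lendD.
Proof. by move=> a b; apply: lendP => f; apply: addrC. Qed.
Lemma lend_add0r : left_id lend0 lendD.
Proof. by move=> a; apply: lendP => f; apply: add0r. Qed.
Lemma lend_addNr : left_inverse lend0 lendN lendD.
Proof. by move=> a; apply: lendP => f; apply: addNr. Qed.
Lemma lend_mulrA : associative lendM.
Proof. by move=> a b c; apply: lendP. Qed.
Lemma lend_mul1r : left_id lend1 lendM.
Proof. by move=> a; apply: lendP. Qed.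
Lemma lend_mulr1 : right_id lend1 lendM.
Proof. by move=> a; apply: lendP. Qed.
Lemma lend_mulrDl : left_distributive lendM lendD.
Proof. by move=> a b c; apply: lendP. Qed.
Lemma lend_mulrDr : right_distributive lendM lendD.
Proof. by move=> a b c; apply: lendP => f; apply: lend_add. Qed.
Lemma lend_oner_neq0 : lend1 != lend0.
Proof.
by apply/eqP => /(congr1 (fun a : lend => a 1)) /= /eqP; rewrite oner_eq0.
Qed.
HB.instance Definition _ := GRing.isNzRing.Build lend
  lend_addrA lend_addrC lend_add0r lend_addNr lend_mulrA lend_mul1r lend_mulr1
  lend_mulrDl lend_mulrDr lend_oner_neq0.

Lemma lend_scalerA a b (v : lend) : lendZ a (lendZ b v) = lendZ (a * b) v.
Proof. by apply: lendP => f; apply: scalerA. Qed.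
Lemma lend_scale1r : left_id 1 lendZ.
Proof. by move=> a; apply: lendP => f; apply: scale1r. Qed.
Lemma lend_scalerDr : right_distributive lendZ +%R.
Proof. by move=> k a b; apply: lendP => f; apply: scalerDr. Qed.
Lemma lend_scalerDl (v : lend) : {morph lendZ^~ v : a b / a + b}.
Proof. by move=> a b; apply: lendP => f; apply: scalerDl. Qed.
HB.instance Definition _ := GRing.Zmodule_isLmodule.Build F lend
  lend_scalerA lend_scale1r lend_scalerDr lend_scalerDl.
Lemma lend_scaleAl k (a b : lend) : k *: (a * b) = (k *: a) * b.
Proof. by apply: lendP. Qed.
HB.instance Definition _ := GRing.Lmodule_isLalgebra.Build F lend lend_scaleAl.
Lemma lend_scaleAr k (a b : lend) : k *: (a * b) = a * (k *: b).
Proof.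
apply: lendP => f; have a0 : a 0 = 0.
  by apply: (addrI (a 0)); rewrite -lend_add !addr0.
by have := lend_linear a k (b f) 0; rewrite a0 !addr0 => E; rewrite [RHS]E.
Qed.
HB.instance Definition _ := GRing.Lalgebra_isAlgebra.Build F lend lend_scaleAr.

Lemma lend1E f : (1 : lend) f = f. Proof. by []. Qed.
Lemma lend0E f : (0 : lend) f = 0. Proof. by []. Qed.
Lemma lendDE (a b : lend) f : (a + b) f = a f + b f. Proof. by []. Qed.
Lemma lendNE (a : lend) f : (- a) f = - a f. Proof. by []. Qed.
Lemma lendME (a b : lend) f : (a * b) f = a (b f). Proof. by []. Qed.
Lemma lendZE k (a : lend) f : (k *: a) f = k *: a f. Proof. by []. Qed.
End LinearEndo.

(* [q4] and [th] stand for q^{1/4} and t^{1/2}; the generators gXV, gYV, gTV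
   stand for X^-1, Y^-1, T^-1. *)
Record daha_param (F : fieldType) := DahaParam {
  q4 : F; th : F; q4_neq0 : q4 != 0; th_neq0 : th != 0 }.

Inductive gen := gX | gXV | gY | gYV | gT | gTV.

Section Daha.
Variables (F : fieldType) (P : daha_param F).
Local Notation q4 := (q4 P).
Local Notation th := (th P).
Local Notation qh := (q4 ^+ 2).

Record daha_rels (A : algType F) (g : gen -> A) : Prop := DahaRels {
  rel_XXV : g gX * g gXV = 1;
  rel_XVX : g gXV * g gX = 1;
  rel_YYV : g gY * g gYV = 1;
  rel_YVY : g gYV * g gY = 1;
  rel_TTV : g gT * g gTV = 1;
  rel_TVT : g gTV * g gT = 1;
  rel_Hecke : (g gT - th%:A) * (g gT + (th^-1)%:A) = 0;
  rel_TXT : g gT * g gX * g gT = g gXV;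
  rel_TYT : g gTV * g gY * g gTV = g gYV;
  rel_YXYX : g gYV * g gXV * g gY * g gX * g gT ^+ 2 * qh%:A = 1 }.

Inductive term : Type :=
  | tC of F | tG of gen | tA of term & term | tM of term & term.
HB.instance Definition _ := gen_eqMixin term.
HB.instance Definition _ := gen_choiceMixin term.

Local Notation "a +' b" := (tA a b) (at level 50, left associativity).
Local Notation "a *' b" := (tM a b) (at level 40, left associativity).

(* The smallest congruence making terms an F-algebra and imposing the
   relations of [daha_rels]. *)
Inductive deq : term -> term -> Prop :=
  | deq_refl a : deq a a
  | deq_sym a b : deq a b -> deq b a
  | deq_trans a b c : deq a b -> deq b c -> deq a c
  | deq_add a a' b b' : deq a a' -> deq b b' -> deq (a +' b) (a' +' b')
  | deq_mul a a' b b' : deq a a' -> deq b b' -> deq (a *' b) (a' *' b')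
  | deq_addA a b c : deq (a +' (b +' c)) (a +' b +' c)
  | deq_addC a b : deq (a +' b) (b +' a)
  | deq_add0 a : deq (tC 0 +' a) a
  | deq_addN a : deq (tC (-1) *' a +' a) (tC 0)
  | deq_mulA a b c : deq (a *' (b *' c)) (a *' b *' c)
  | deq_mul1 a : deq (tC 1 *' a) a
  | deq_mulDl a b c : deq ((a +' b) *' c) (a *' c +' b *' c)
  | deq_mulDr a b c : deq (a *' (b +' c)) (a *' b +' a *' c)
  | deq_cstD c d : deq (tC (c + d)) (tC c +' tC d)
  | deq_cstM c d : deq (tC (c * d)) (tC c *' tC d)
  | deq_cstC c a : deq (tC c *' a) (a *' tC c)
  | deq_XXV : deq (tG gX *' tG gXV) (tC 1)
  | deq_XVX : deq (tG gXV *' tG gX) (tC 1)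
  | deq_YYV : deq (tG gY *' tG gYV) (tC 1)
  | deq_YVY : deq (tG gYV *' tG gY) (tC 1)
  | deq_TTV : deq (tG gT *' tG gTV) (tC 1)
  | deq_TVT : deq (tG gTV *' tG gT) (tC 1)
  | deq_Hecke : deq ((tG gT +' tC (- th)) *' (tG gT +' tC th^-1)) (tC 0)
  | deq_TXT : deq (tG gT *' tG gX *' tG gT) (tG gXV)
  | deq_TYT : deq (tG gTV *' tG gY *' tG gTV) (tG gYV)
  | deq_YXYX : deq (tG gYV *' tG gXV *' tG gY *' tG gX *' (tG gT *' tG gT) *' tC qh)
                   (tC 1).

Definition deqb : rel term := fun a b => `[< deq a b >].

Lemma deqb_refl : reflexive deqb.
Proof. by move=> a; apply/asboolP; apply: deq_refl. Qed.
Lemma deqb_sym : symmetric deqb.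
Proof. by move=> a b; apply/asboolP/asboolP; apply: deq_sym. Qed.
Lemma deqb_trans : transitive deqb.
Proof.
by move=> b a c /asboolP ab /asboolP bc; apply/asboolP; apply: deq_trans ab bc.
Qed.
Canonical deqb_equiv := EquivRel deqb deqb_refl deqb_sym deqb_trans.

(* The double affine Hecke algebra of type A_1. *)
Definition daha := {eq_quot deqb}.
HB.instance Definition _ : EqQuotient _ deqb daha := EqQuotient.on daha.
HB.instance Definition _ := Choice.on daha.

Definition hpi (a : term) : daha := \pi a.

Lemma hpi_eq a b : hpi a = hpi b <-> deq a b.
Proof. by split=> [/eqmodP/asboolP|ab] //; apply/eqmodP/asboolP. Qed.
Lemma hpi_repr (x : daha) : hpi (repr x) = x.
Proof. exact: reprK. Qed.
Lemma repr_hpi a : deq (repr (hpi a)) a.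
Proof. by apply/hpi_eq; rewrite hpi_repr. Qed.
Lemma hpi_ind (Q : daha -> Prop) : (forall a, Q (hpi a)) -> forall x, Q x.
Proof. by move=> Qh x; rewrite -(hpi_repr x). Qed.

Definition hadd (x y : daha) := hpi (repr x +' repr y).
Definition hmul (x y : daha) := hpi (repr x *' repr y).
Definition hopp (x : daha) := hpi (tC (-1) *' repr x).

Lemma haddE a b : hadd (hpi a) (hpi b) = hpi (a +' b).
Proof. by apply/hpi_eq; apply: deq_add; apply: repr_hpi. Qed.
Lemma hmulE a b : hmul (hpi a) (hpi b) = hpi (a *' b).
Proof. by apply/hpi_eq; apply: deq_mul; apply: repr_hpi. Qed.
Lemma hoppE a : hopp (hpi a) = hpi (tC (-1) *' a).
Proof. by apply/hpi_eq; apply: deq_mul; [apply: deq_refl | apply: repr_hpi]. Qed.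

Let hE := (haddE, hmulE, hoppE).

Lemma haddA : associative hadd.
Proof.
elim/hpi_ind=> a; elim/hpi_ind=> b; elim/hpi_ind=> c; rewrite !hE.
by apply/hpi_eq; apply: deq_addA.
Qed.
Lemma haddC : commutative hadd.
Proof.
elim/hpi_ind=> a; elim/hpi_ind=> b; rewrite !hE.
by apply/hpi_eq; apply: deq_addC.
Qed.
Lemma hadd0 : left_id (hpi (tC 0)) hadd.
Proof. by elim/hpi_ind=> a; rewrite hE; apply/hpi_eq; apply: deq_add0. Qed.
Lemma haddN : left_inverse (hpi (tC 0)) hopp hadd.
Proof. by elim/hpi_ind=> a; rewrite !hE; apply/hpi_eq; apply: deq_addN. Qed.
Lemma hmulA : associative hmul.
Proof.
elim/hpi_ind=> a; elim/hpi_ind=> b; elim/hpi_ind=> c; rewrite !hE.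
by apply/hpi_eq; apply: deq_mulA.
Qed.
Lemma hmul1 : left_id (hpi (tC 1)) hmul.
Proof. by elim/hpi_ind=> a; rewrite hE; apply/hpi_eq; apply: deq_mul1. Qed.
Lemma hmulr1 : right_id (hpi (tC 1)) hmul.
Proof.
elim/hpi_ind=> a; rewrite hE; apply/hpi_eq.
by apply: deq_trans (deq_mul1 a); apply: deq_sym; apply: deq_cstC.
Qed.
Lemma hmulDl : left_distributive hmul hadd.
Proof.
elim/hpi_ind=> a; elim/hpi_ind=> b; elim/hpi_ind=> c; rewrite !hE.
by apply/hpi_eq; apply: deq_mulDl.
Qed.
Lemma hmulDr : right_distributive hmul hadd.
Proof.
elim/hpi_ind=> a; elim/hpi_ind=> b; elim/hpi_ind=> c; rewrite !hE.
by apply/hpi_eq; apply: deq_mulDr.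
Qed.

Fixpoint teval (A : algType F) (g : gen -> A) (a : term) : A :=
  match a with
  | tC c => c%:A
  | tG x => g x
  | a +' b => teval g a + teval g b
  | a *' b => teval g a * teval g b
  end.

Lemma teval_deq (A : algType F) (g : gen -> A) :
  daha_rels g -> forall a b, deq a b -> teval g a = teval g b.
Proof.
move=> [] XXV XVX YYV YVY TTV TVT He TXT TYT YXYX a b.
elim=> //=.
- by move=> {a b} a b c _ -> _ ->.
- by move=> {a b} a a' b b' _ -> _ ->.
- by move=> {a b} a a' b b' _ -> _ ->.
- by move=> {a b} a b c; rewrite addrA.
- by move=> {a b} a b; rewrite addrC.
- by move=> {a b} a; rewrite scale0r add0r.
- by move=> {a b} a; rewrite scaleN1r mulN1r addNr scale0r.
- by move=> {a b} a b c; rewrite mulrA.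
- by move=> {a b} a; rewrite scale1r mul1r.
- by move=> {a b} a b c; rewrite mulrDl.
- by move=> {a b} a b c; rewrite mulrDr.
- by move=> {a b} c d; rewrite scalerDl.
- by move=> {a b} c d; rewrite mulr_algl scalerA.
- by move=> {a b} c a; rewrite mulr_algl mulr_algr.
- by rewrite scale1r.
- by rewrite scale1r.
- by rewrite scale1r.
- by rewrite scale1r.
- by rewrite scale1r.
- by rewrite scale1r.
- by rewrite scaleNr scale0r.
- by rewrite -expr2 scale1r.
Qed.

Lemma daha_rels_poly_nz (A : algType F) (g : gen -> A) : daha_rels g ->
  hpi (tC 1) != hpi (tC 0).
Proof.
move=> gP; apply/eqP => /hpi_eq /(teval_deq gP) /= /eqP.
by rewrite scale1r scale0r oner_eq0.
Qed.

Lemma lT_subproof : linear (fun f : laurent F =>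
  th *: linv f + (th - th^-1) *: ldiff f).
Proof.
have E f : lval (th *: linv f + (th - th^-1) *: ldiff f) =
    Tform (cstX th) (varX F) (lval f) (lval (linv f)).
  by rewrite lvalD !lval_scale rmorphB fmorphV.
move=> c f g; apply: lval_inj; rewrite [RHS]lvalD lval_scale !E.
rewrite linvD linvZ !lvalD !lval_scale TformD //.
  by rewrite fmorph_eq0 th_neq0.
exact: varX_sqrB1_neq0.
Qed.

(* T = t^{1/2} s + (t^{1/2} - t^{-1/2}) / (X^2 - 1) (s - 1) *)
Definition opT : lend F := Lend lT_subproof.

Lemma opTE f : opT f = th *: linv f + (th - th^-1) *: ldiff f.
Proof. by []. Qed.

Lemma lval_opT f :
  lval (opT f) = Tform (cstX th) (varX F) (lval f) (lval (linv f)).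
Proof. by rewrite lvalD !lval_scale rmorphB fmorphV. Qed.

Lemma lval_linv_opT f :
  lval (linv (opT f)) = Tform (cstX th) (varX F)^-1 (lval (linv f)) (lval f).
Proof.
have xV1 := Tform_denV (varX_neq0 F) (varX_sqrB1_neq0 F).
have D : lval (linv (ldiff f)) = (lval f - lval (linv f)) / ((varX F)^-1 ^+ 2 - 1).
  have := congr1 (fun h => lval (linv h)) (ldiffE f).
  rewrite linvM !linvB linv1 linvXn linvX linvK.
  by rewrite lvalM !lvalB lvalXn lval1 => <-; rewrite mulrC mulKf.
by rewrite opTE linvD !linvZ linvK lvalD !lval_scale D rmorphB fmorphV.
Qed.

Let qh_neq0 : qh != 0. Proof. exact: expf_neq0 (q4_neq0 P). Qed.

Let lpi_inv : (qh *: lXV F) * (qh^-1 *: lX F) = 1.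
Proof. by rewrite -scalerAl -scalerAr lXVX scalerA divff // scale1r. Qed.

(* pi(f)(X) = f(q^{1/2} X^{-1}) *)
Definition oppi : lend F := Lend (lsubst_linear lpi_inv).
Lemma oppiM f g : oppi (f * g) = oppi f * oppi g.
Proof. exact: (lsubst_monoid_morphism lpi_inv).2. Qed.
Lemma oppiX : oppi (lX F) = qh *: lXV F.
Proof. exact: lsubst_X lpi_inv. Qed.
Lemma oppiXV : oppi (lXV F) = qh^-1 *: lX F.
Proof. exact: lsubst_XV lpi_inv. Qed.

Lemma opX_subproof : linear (fun f : laurent F => lX F * f).
Proof. by move=> c f g; rewrite mulrDr scalerAr. Qed.
Lemma opXV_subproof : linear (fun f : laurent F => lXV F * f).
Proof. by move=> c f g; rewrite mulrDr scalerAr. Qed.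

Definition opX : lend F := Lend opX_subproof.
Definition opXV : lend F := Lend opXV_subproof.
Definition opTV : lend F := opT - (th - th^-1)%:A.

Definition poly_rep_gen (x : gen) : lend F :=
  match x with
  | gX => opX | gXV => opXV
  | gT => opT | gTV => opTV
  | gY => oppi * opT | gYV => opTV * oppi
  end.

Lemma opXXV : opX * opXV = 1.
Proof. by apply: lendP => f; rewrite lendME /= mulrA lXXV mul1r. Qed.
Lemma opXVX : opXV * opX = 1.
Proof. by apply: lendP => f; rewrite lendME /= mulrA lXVX mul1r. Qed.

Lemma oppiK : oppi * oppi = 1.
Proof.
apply: lendP => f; rewrite lendME lend1E.
elim/laurent_ind: f => [f g Ef Eg|c f Ef|n|n].
- by rewrite !lend_add Ef Eg.
- have Z k (g : laurent F) : oppi (k *: g) = k *: oppi g.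
    exact: (lsubst_scale lpi_inv).
  by rewrite !Z Ef.
- elim: n => [|n IH]; last first.
    rewrite exprS 2!oppiM IH oppiX; congr (_ * _).
    rewrite [LHS](lsubst_scale lpi_inv) -/oppi.
    rewrite (lsubst_XV lpi_inv) scalerA divff ?scale1r //; exact: qh_neq0.
  by rewrite expr0 -[LHS]/(lsubst _ _ (lsubst _ _ 1)) !(lsubst_monoid_morphism lpi_inv).1.
- elim: n => [|n IH]; last first.
    rewrite exprS 2!oppiM IH oppiXV; congr (_ * _).
    rewrite [LHS](lsubst_scale lpi_inv) -/oppi.
    rewrite (lsubst_X lpi_inv) scalerA mulVf ?scale1r //; exact: qh_neq0.
  by rewrite expr0 -[LHS]/(lsubst _ _ (lsubst _ _ 1)) !(lsubst_monoid_morphism lpi_inv).1.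
Qed.

Let cth0 : cstX th != 0. Proof. by rewrite fmorph_eq0 th_neq0. Qed.

Lemma opT_sqr : opT * opT = (th - th^-1) *: opT + 1.
Proof.
apply: lendP => f; rewrite lendME lendDE lendZE lend1E; apply: lval_inj.
rewrite lvalD lval_scale lval_opT lval_linv_opT lval_opT rmorphB fmorphV.
by rewrite Tform_Hecke ?varX_neq0 ?varX_sqrB1_neq0.
Qed.

Lemma opTXT : opT * opX * opT = opXV.
Proof.
apply: lendP => f; rewrite !lendME; apply: lval_inj.
rewrite lval_opT -[opX _]/(lX F * opT f) linvM linvX (lvalM (lX F)) (lvalM (lXV F) (linv _)).
rewrite lval_linv_opT lval_opT.
by rewrite Tform_TXT ?varX_neq0 ?varX_sqrB1_neq0 // -[opXV f]/(lXV F * f) lvalM.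
Qed.

Lemma opTTV : opT * opTV = 1.
Proof. by rewrite mulrBr mulr_algr opT_sqr addrC addKr. Qed.
Lemma opTVT : opTV * opT = 1.
Proof. by rewrite mulrBl mulr_algl opT_sqr addrC addKr. Qed.

Lemma oppiXVpi : oppi * opXV * oppi = qh^-1 *: opX.
Proof.
apply: lendP => f; rewrite !lendME lendZE /= -/(oppi f).
rewrite -[LHS]/(oppi (lXV F * oppi f)) oppiM oppiXV -lendME oppiK lend1E.
by rewrite -scalerAl.
Qed.

Lemma YXYX_aux (A : algType F) (x xV t tV p : A) :
    x * xV = 1 -> tV * t = 1 -> t * x * t = xV -> p * xV * p = qh^-1 *: x ->
  tV * p * xV * (p * t) * x * t ^+ 2 * qh%:A = 1.
Proof.
move=> xxV tVt txt pxVp.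
have -> : tV * p * xV * (p * t) * x * t ^+ 2 =
    tV * (p * xV * p) * (t * x * t) * t by rewrite expr2 !mulrA.
rewrite mulr_algr pxVp txt -scalerAr -!scalerAl -[tV * _ * _]mulrA.
by rewrite xxV mulr1 tVt scalerA divff ?scale1r.
Qed.

Lemma poly_rep_rels : daha_rels poly_rep_gen.
Proof.
split=> /=.
- exact: opXXV.
- exact: opXVX.
- by rewrite mulrA -[_ * opT * _]mulrA opTTV mulr1 oppiK.
- by rewrite mulrA -[opTV * oppi * _]mulrA oppiK mulr1 opTVT.
- exact: opTTV.
- exact: opTVT.
- rewrite mulrDr mulrBl mulrBl mulr_algl mulr_algr mulr_algl scalerA.
  rewrite -expr2 expr2 opT_sqr divff ?th_neq0 // scale1r scalerBl.
  set u := th *: opT; set w := th^-1 *: opT.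
  by rewrite addrAC addrACA subrK subrr addr0 subrr.
- exact: opTXT.
- by rewrite mulrA -[_ * opT * _]mulrA opTTV mulr1.
- exact: YXYX_aux opXXV opTVT opTXT oppiXVpi.
Qed.

Lemma hone_neq0 : hpi (tC 1) != hpi (tC 0).
Proof. exact: daha_rels_poly_nz poly_rep_rels. Qed.

HB.instance Definition _ := GRing.isNzRing.Build daha
  haddA haddC hadd0 haddN hmulA hmul1 hmulr1 hmulDl hmulDr hone_neq0.

Definition hscale (c : F) (x : daha) : daha := hpi (tC c) * x.
Lemma hpiD a b : hpi (a +' b) = hpi a + hpi b. Proof. exact/esym/haddE. Qed.
Lemma hpiM a b : hpi (a *' b) = hpi a * hpi b. Proof. exact/esym/hmulE. Qed.
Lemma hpi_cstM c d : hpi (tC (c * d)) = hpi (tC c) * hpi (tC d).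
Proof. by rewrite -hpiM; apply/hpi_eq; apply: deq_cstM. Qed.
Lemma hpi_cstD c d : hpi (tC (c + d)) = hpi (tC c) + hpi (tC d).
Proof. by rewrite -hpiD; apply/hpi_eq; apply: deq_cstD. Qed.
Lemma hpi_cstC c x : hpi (tC c) * x = x * hpi (tC c).
Proof.
by elim/hpi_ind: x => a; rewrite -!hpiM; apply/hpi_eq; apply: deq_cstC.
Qed.
Lemma hscaleA a b x : hscale a (hscale b x) = hscale (a * b) x.
Proof. by rewrite /hscale mulrA hpi_cstM. Qed.
Lemma hscale1 : left_id 1 hscale.
Proof. by move=> x; rewrite /hscale mul1r. Qed.
Lemma hscaleDr : right_distributive hscale +%R.
Proof. by move=> a x y; rewrite /hscale mulrDr. Qed.
Lemma hscaleDl x : {morph hscale^~ x : a b / a + b}.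
Proof. by move=> a b; rewrite /hscale hpi_cstD mulrDl. Qed.
HB.instance Definition _ :=
  GRing.Zmodule_isLmodule.Build F daha hscaleA hscale1 hscaleDr hscaleDl.
Lemma hscaleE c (x : daha) : c *: x = hpi (tC c) * x. Proof. by []. Qed.
Lemma hscaleAl c (x y : daha) : c *: (x * y) = (c *: x) * y.
Proof. by rewrite !hscaleE mulrA. Qed.
HB.instance Definition _ := GRing.Lmodule_isLalgebra.Build F daha hscaleAl.
Lemma hscaleAr c (x y : daha) : c *: (x * y) = x * (c *: y).
Proof. by rewrite !hscaleE !mulrA hpi_cstC. Qed.
HB.instance Definition _ := GRing.Lalgebra_isAlgebra.Build F daha hscaleAr.

Definition hgen (x : gen) : daha := hpi (tG x).
Definition hX := hgen gX.
Definition hXV := hgen gXV.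
Definition hY := hgen gY.
Definition hYV := hgen gYV.
Definition hT := hgen gT.
Definition hTV := hgen gTV.

Lemma hpi_teval a : hpi a = teval hgen a.
Proof.
elim: a => [c|x|a IHa b IHb|a IHa b IHb] /=; first by rewrite hscaleE mulr1.
- by [].
- by rewrite hpiD IHa IHb.
- by rewrite hpiM IHa IHb.
Qed.

Lemma hgen_rels : daha_rels hgen.
Proof.
have E a b : deq a b -> teval hgen a = teval hgen b.
  by move/hpi_eq; rewrite !hpi_teval.
split.
- by have := E _ _ deq_XXV; rewrite /= scale1r.
- by have := E _ _ deq_XVX; rewrite /= scale1r.
- by have := E _ _ deq_YYV; rewrite /= scale1r.
- by have := E _ _ deq_YVY; rewrite /= scale1r.
- by have := E _ _ deq_TTV; rewrite /= scale1r.
- by have := E _ _ deq_TVT; rewrite /= scale1r.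
- by have := E _ _ deq_Hecke; rewrite /= scaleNr scale0r.
- exact: E _ _ deq_TXT.
- exact: E _ _ deq_TYT.
- by have := E _ _ deq_YXYX; rewrite /= scale1r expr2.
Qed.

(* The algebra morphism from the double affine Hecke algebra that sends the
   generators to elements satisfying its relations. *)
Definition hlift (A : algType F) (g : gen -> A) (gP : daha_rels g) : daha -> A :=
  fun x => teval g (repr x).

Section Lift.
Variables (A : algType F) (g : gen -> A) (gP : daha_rels g).

Lemma hlift_hpi a : hlift gP (hpi a) = teval g a.
Proof. exact/(teval_deq gP)/repr_hpi. Qed.
Lemma hliftD x y : hlift gP (x + y) = hlift gP x + hlift gP y.
Proof.
by elim/hpi_ind: x => a; elim/hpi_ind: y => b; rewrite -hpiD !hlift_hpi.
Qed.
Lemma hliftZ c x : hlift gP (c *: x) = c *: hlift gP x.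
Proof.
by elim/hpi_ind: x => a; rewrite hscaleE -hpiM !hlift_hpi /= mulr_algl.
Qed.
Lemma hlift_zmod_morphism : zmod_morphism (hlift gP).
Proof. by move=> x y; rewrite -scaleN1r hliftD hliftZ scaleN1r. Qed.
Lemma hlift_monoid_morphism : monoid_morphism (hlift gP).
Proof.
split=> [|x y].
  by rewrite [LHS]hlift_hpi /= scale1r.
by elim/hpi_ind: x => a; elim/hpi_ind: y => b; rewrite -hpiM !hlift_hpi.
Qed.
HB.instance Definition _ := GRing.isZmodMorphism.Build daha A (hlift gP)
  hlift_zmod_morphism.
HB.instance Definition _ := GRing.isMonoidMorphism.Build daha A (hlift gP)
  hlift_monoid_morphism.
HB.instance Definition _ := GRing.isScalable.Build F daha A *:%R (hlift gP) hliftZ.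

Lemma hlift_gen x : hlift gP (hgen x) = g x.
Proof. exact: hlift_hpi. Qed.

Lemma hlift_uniq (f : {lrmorphism daha -> A}) :
  (forall x, f (hgen x) = g x) -> f =1 hlift gP.
Proof.
move=> fg; elim/hpi_ind=> a; rewrite hlift_hpi hpi_teval.
elim: a => [c|x|a IHa b IHb|a IHa b IHb] /=.
- by rewrite linearZ rmorph1.
- exact: fg.
- by rewrite rmorphD /= IHa IHb.
- by rewrite rmorphM /= IHa IHb.
Qed.
End Lift.

Lemma tau_aux (A : algType F) (g : gen -> A) : daha_rels g ->
  [/\ g gTV * g gX * g gY * g gTV = qh *: (g gYV * g gXV),
      qh *: (g gTV * g gXV * g gY * g gTV) = g gYV * g gX,
      qh *: (g gT * g gY * g gX * g gT) = g gXV * g gYV &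
      g gT * g gYV * g gX * g gT = qh *: (g gXV * g gY)].
Proof.
case; move: (g gX) (g gXV) (g gY) (g gYV) (g gT) (g gTV).
move=> X X' Y Y' T T' XXV XVX YYV YVY TTV TVT _ TXT TYT YXYX.
have XX' a : a * X * X' = a by rewrite -mulrA XXV mulr1.
have X'X a : a * X' * X = a by rewrite -mulrA XVX mulr1.
have YY' a : a * Y * Y' = a by rewrite -mulrA YYV mulr1.
have Y'Y a : a * Y' * Y = a by rewrite -mulrA YVY mulr1.
have TT' a : a * T * T' = a by rewrite -mulrA TTV mulr1.
have T'T a : a * T' * T = a by rewrite -mulrA TVT mulr1.
have XT a : a * X * T = a * T' * X'.
  by rewrite -TXT !mulrA T'T.
have YT' a : a * Y * T' = a * T * Y'.
  by rewrite -TYT !mulrA TT'.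
have XY : X * Y = qh *: (Y * X * T * T).
  have := congr1 (fun a => X * Y * a) YXYX.
  rewrite mulr1 mulr_algr -scalerAr expr2 !mulrA => <-; congr (_ *: _).
  by rewrite YY' XXV mul1r.
have TTXY : T' * T' * X' * Y' = qh *: (Y' * X').
  have := congr1 (fun a => Y' * X' * a * T' * T' * X' * Y') XY.
  by rewrite -scalerAr -!scalerAl !mulrA X'X YVY mul1r !TT' XX' YY'.
split.
- by rewrite YT' XT TTXY.
- rewrite -TXT !mulrA TVT mul1r YT'.
  have := congr1 (fun a => Y' * a * Y') XY.
  by rewrite -scalerAr -scalerAl !mulrA YY' YVY mul1r => ->.
- rewrite XT YT' -[T * T * Y' * X']mulrA scalerAr -TTXY !mulrA TT'.
  by rewrite TTV mul1r.
- rewrite XT -TYT !mulrA TTV mul1r.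
  have := congr1 (fun a => X' * a * T' * T' * X') XY.
  by rewrite -scalerAr -!scalerAl !mulrA XVX mul1r !TT' XX' => ->.
Qed.

Section Tau.
Variables (A : algType F) (g : gen -> A) (gP : daha_rels g).

(* Images of the generators under tau_+, tau_+^-1, tau_-, tau_-^-1. *)
Definition tauP_gen (x : gen) : A :=
  match x with
  | gY => q4^-1 *: (g gX * g gY) | gYV => q4 *: (g gYV * g gXV) | x => g x
  end.
Definition tauPV_gen (x : gen) : A :=
  match x with
  | gY => q4 *: (g gXV * g gY) | gYV => q4^-1 *: (g gYV * g gX) | x => g x
  end.
Definition tauM_gen (x : gen) : A :=
  match x with
  | gX => q4 *: (g gY * g gX) | gXV => q4^-1 *: (g gXV * g gYV) | x => g x
  end.
Definition tauMV_gen (x : gen) : A :=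
  match x with
  | gX => q4^-1 *: (g gYV * g gX) | gXV => q4 *: (g gXV * g gY) | x => g x
  end.

Let sM (a b : F) (x y : A) : (a *: x) * (b *: y) = (a * b) *: (x * y).
Proof. by rewrite -[LHS]scalerAl -scalerAr scalerA. Qed.
Let sMM (a b : F) (x y z : A) : (a *: x) * y * (b *: z) = (a * b) *: (x * y * z).
Proof. by rewrite -scalerAl sM. Qed.
Let sMMM (a b : F) (x y z t : A) :
  x * (a *: y) * z * (b *: t) = (a * b) *: (x * y * z * t).
Proof. by rewrite -!scalerAr -!scalerAl scalerA mulrC. Qed.
Let qV0 : q4^-1 * q4 = 1. Proof. by rewrite mulVf ?q4_neq0. Qed.
Let q0V : q4 * q4^-1 = 1. Proof. by rewrite mulfV ?q4_neq0. Qed.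

Lemma tauP_rels : daha_rels tauP_gen.
Proof.
have := tau_aux gP; case: gP => XXV XVX YYV YVY TTV TVT He TXT TYT YXYX.
case=> E _ _ _; split=> //=.
- by rewrite sM qV0 scale1r mulrA -[g gX * _ * _]mulrA YYV mulr1 XXV.
- by rewrite sM q0V scale1r mulrA -[g gYV * _ * _]mulrA XVX mulr1 YVY.
- by rewrite -scalerAr -scalerAl mulrA E scalerA expr2 mulrA qV0 mul1r.
- rewrite sMM q0V scale1r -[RHS]YXYX; congr (_ * _ * _ * _).
  by rewrite !mulrA -[_ * g gXV * g gX]mulrA XVX mulr1.
Qed.

Lemma tauPV_rels : daha_rels tauPV_gen.
Proof.
have := tau_aux gP; case: gP => XXV XVX YYV YVY TTV TVT He TXT TYT YXYX.
case=> _ E _ _; split=> //=.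
- by rewrite sM q0V scale1r mulrA -[g gXV * _ * _]mulrA YYV mulr1 XVX.
- by rewrite sM qV0 scale1r mulrA -[g gYV * _ * _]mulrA XXV mulr1 YVY.
- by rewrite -scalerAr -scalerAl mulrA -E scalerA expr2 mulrA qV0 mul1r.
- rewrite sMM qV0 scale1r -[RHS]YXYX; congr (_ * _ * _ * _).
  by rewrite !mulrA -[_ * g gX * g gXV]mulrA XXV mulr1.
Qed.

Lemma tauM_rels : daha_rels tauM_gen.
Proof.
have := tau_aux gP; case: gP => XXV XVX YYV YVY TTV TVT He TXT TYT YXYX.
case=> _ _ E _; split=> //=.
- by rewrite sM q0V scale1r mulrA -[g gY * _ * _]mulrA XXV mulr1 YYV.
- by rewrite sM qV0 scale1r mulrA -[g gXV * _ * _]mulrA YVY mulr1 XVX.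
- by rewrite -scalerAr -scalerAl mulrA -E scalerA expr2 mulrA qV0 mul1r.
- rewrite -[RHS]YXYX; congr (_ * _ * _).
  rewrite sMMM qV0 scale1r.
  by rewrite !mulrA -[_ * g gYV * g gY]mulrA YVY mulr1.
Qed.

Lemma tauMV_rels : daha_rels tauMV_gen.
Proof.
have := tau_aux gP; case: gP => XXV XVX YYV YVY TTV TVT He TXT TYT YXYX.
case=> _ _ _ E; split=> //=.
- by rewrite sM qV0 scale1r mulrA -[g gYV * _ * _]mulrA XXV mulr1 YVY.
- by rewrite sM q0V scale1r mulrA -[g gXV * _ * _]mulrA YYV mulr1 XVX.
- by rewrite -scalerAr -scalerAl mulrA E scalerA expr2 mulrA qV0 mul1r.
- rewrite -[RHS]YXYX; congr (_ * _ * _).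
  rewrite sMMM q0V scale1r.
  by rewrite !mulrA -[_ * g gY * g gYV]mulrA YYV mulr1.
Qed.
End Tau.

Definition tauP : {lrmorphism daha -> daha} := hlift (tauP_rels hgen_rels).
Definition tauPV : {lrmorphism daha -> daha} := hlift (tauPV_rels hgen_rels).
Definition tauM : {lrmorphism daha -> daha} := hlift (tauM_rels hgen_rels).
Definition tauMV : {lrmorphism daha -> daha} := hlift (tauMV_rels hgen_rels).

Lemma tauP_hgen x : tauP (hgen x) = tauP_gen hgen x.
Proof. exact: hlift_gen. Qed.
Lemma tauPV_hgen x : tauPV (hgen x) = tauPV_gen hgen x.
Proof. exact: hlift_gen. Qed.
Lemma tauM_hgen x : tauM (hgen x) = tauM_gen hgen x.
Proof. exact: hlift_gen. Qed.
Lemma tauMV_hgen x : tauMV (hgen x) = tauMV_gen hgen x.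
Proof. exact: hlift_gen. Qed.

Lemma daha_end_id (f : {lrmorphism daha -> daha}) :
  (forall x, f (hgen x) = hgen x) -> f =1 id.
Proof.
move=> fE x; rewrite (hlift_uniq hgen_rels fE).
by rewrite -(hlift_uniq (f := idfun) hgen_rels).
Qed.

Lemma tauPK : cancel tauP tauPV.
Proof.
apply: (daha_end_id (f := tauPV \o tauP)).
have [XXV XVX YYV YVY _ _ _ _ _ _] := hgen_rels; have q0 := q4_neq0 P.
case; rewrite /= tauP_hgen /= ?linearZ ?rmorphM /= ?tauPV_hgen //=.
- by rewrite -scalerAr scalerA mulVf // scale1r mulrA XXV mul1r.
- by rewrite -scalerAl scalerA mulfV // scale1r -mulrA XXV mulr1.
Qed.
Lemma tauPVK : cancel tauPV tauP.
Proof.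
apply: (daha_end_id (f := tauP \o tauPV)).
have [XXV XVX YYV YVY _ _ _ _ _ _] := hgen_rels; have q0 := q4_neq0 P.
case; rewrite /= tauPV_hgen /= ?linearZ ?rmorphM /= ?tauP_hgen //=.
- by rewrite -scalerAr scalerA mulfV // scale1r mulrA XVX mul1r.
- by rewrite -scalerAl scalerA mulVf // scale1r -mulrA XVX mulr1.
Qed.
Lemma tauMK : cancel tauM tauMV.
Proof.
apply: (daha_end_id (f := tauMV \o tauM)).
have [XXV XVX YYV YVY _ _ _ _ _ _] := hgen_rels; have q0 := q4_neq0 P.
case; rewrite /= tauM_hgen /= ?linearZ ?rmorphM /= ?tauMV_hgen //=.
- by rewrite -scalerAr scalerA mulfV // scale1r mulrA YYV mul1r.
- by rewrite -scalerAl scalerA mulVf // scale1r -mulrA YYV mulr1.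
Qed.
Lemma tauMVK : cancel tauMV tauM.
Proof.
apply: (daha_end_id (f := tauM \o tauMV)).
have [XXV XVX YYV YVY _ _ _ _ _ _] := hgen_rels; have q0 := q4_neq0 P.
case; rewrite /= tauMV_hgen /= ?linearZ ?rmorphM /= ?tauM_hgen //=.
- by rewrite -scalerAr scalerA mulVf // scale1r mulrA YVY mul1r.
- by rewrite -scalerAl scalerA mulfV // scale1r -mulrA YVY mulr1.
Qed.

Definition poly_rep : {lrmorphism daha -> lend F} := hlift poly_rep_rels.

Lemma poly_rep_hX f : poly_rep hX f = lX F * f.
Proof. by rewrite [poly_rep _]hlift_gen. Qed.
Lemma poly_rep_hT f : poly_rep hT f = opT f.
Proof. by rewrite [poly_rep _]hlift_gen. Qed.
Lemma poly_rep_hY f : poly_rep hY f = oppi (opT f).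
Proof. by rewrite [poly_rep _]hlift_gen. Qed.

(* {H} = H(1) at X = t^{-1/2} *)
Definition daha_ev (H : daha) : F := leval th^-1 (poly_rep H 1).
End Daha.

(* The Macdonald polynomial P_b = X^b + X^{b-2} + ... + X^{-b} at t = q, with
   [x] for X and [xV] for X^{-1}. *)
Definition macP (R : nzRingType) (b : nat) (x xV : R) : R :=
  \sum_(k < b.+1) x ^+ (b - k) * xV ^+ k.

Lemma macP_quotient (R : nzRingType) b (x xV : R) : x * xV = 1 -> xV * x = 1 ->
  (x - xV) * macP b x xV = x ^+ b.+1 - xV ^+ b.+1.
Proof. by move=> xxV xVx; rewrite subrXX_comm // /GRing.comm xxV. Qed.

Definition mx22 (a b c d : int) : 'M[int]_2 :=
  \matrix_(i < 2, j < 2) nth 0 (nth [::] [:: [:: a; b]; [:: c; d]] i) j.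

Inductive tau_letter := TauP | TauPV | TauM | TauMV.

Definition letter_mx (l : tau_letter) : 'M[int]_2 :=
  match l with
  | TauP => mx22 1 1 0 1 | TauPV => invmx (mx22 1 1 0 1)
  | TauM => mx22 1 0 1 1 | TauMV => invmx (mx22 1 0 1 1)
  end.

(* The word l1 l2 ... ln stands for the product of matrices and for the
   composite l1 o l2 o ... o ln of automorphisms. *)
Definition word_mx (w : seq tau_letter) : 'M[int]_2 :=
  foldr (fun l M => letter_mx l *m M) 1%:M w.

Section Words.
Variables (F : fieldType) (P : daha_param F).

Definition letter_aut (l : tau_letter) : daha P -> daha P :=
  match l with
  | TauP => tauP P | TauPV => tauPV P | TauM => tauM P | TauMV => tauMV P
  end.

Definition word_aut (w : seq tau_letter) : daha P -> daha P :=
  foldr (fun l f => letter_aut l \o f) id w.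

Definition Jsharp (w : seq tau_letter) (b : nat) : F :=
  daha_ev (word_aut w (macP b (hX P) (hXV P))).
End Words.

Lemma letter_mxPV : letter_mx TauPV = mx22 1 (-1) 0 1.
Proof.
have E : mx22 1 1 0 1 *m mx22 1 (-1) 0 1 = 1%:M.
  by apply/matrixP => -[[|[|//]] ?] [[|[|//]] ?]; rewrite !mxE !big_ord_recl big_ord0 !mxE.
by have [U _] := mulmx1_unit E; rewrite /= -[invmx _]mulmx1 -E mulKmx.
Qed.
Lemma letter_mxMV : letter_mx TauMV = mx22 1 0 (-1) 1.
Proof.
have E : mx22 1 0 1 1 *m mx22 1 0 (-1) 1 = 1%:M.
  by apply/matrixP => -[[|[|//]] ?] [[|[|//]] ?]; rewrite !mxE !big_ord_recl big_ord0 !mxE.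
by have [U _] := mulmx1_unit E; rewrite /= -[invmx _]mulmx1 -E mulKmx.
Qed.

(* The field Q(q^{1/4}); [vq] is q^{1/4}. *)
Definition Kq : fieldType := {fraction {poly rat}}.
Definition vq : Kq := ('X : {poly rat})%:F.

Lemma vq_neq0 : vq != 0.
Proof. by rewrite tofrac_eq0 polyX_eq0. Qed.

(* The specialization t = q, that is, t^{1/2} = q^{1/2}. *)
Definition param_tq : daha_param Kq :=
  DahaParam vq_neq0 (expf_neq0 2 vq_neq0).

(* q^x for x in (1/4)Z; at other rationals the value is meaningless. *)
Definition qpow (x : rat) : Kq := vq ^ numq (4 * x).

Lemma qpow_quarter (n : int) : qpow (n%:~R / 4) = vq ^ n.
Proof. by rewrite /qpow mulrC divfK // numq_int. Qed.

(* f is a Laurent polynomial in q^{1/4} and m is the power of q^{1/4} of lowest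
   degree occurring in f. *)
Definition lowest_monomial (f m : Kq) : Prop :=
  exists (p : {poly rat}) (k : int),
    [/\ p`_0 != 0, f = p%:F * vq ^ k & m = vq ^ k].

Lemma lowest_monomial_uniq f m m' :
  lowest_monomial f m -> lowest_monomial f m' -> m = m'.
Proof.
move=> [p [k [p0 -> ->]]] [p' [k' [p'0 E ->]]]; move: E.
wlog le_kk' : p p' k k' p0 p'0 / k <= k' => [W E|].
  have [le_kk'|/ltW le_k'k] := leP k k'; first exact: (W p p').
  by apply/esym/(W p' p).
have [n ->] : exists n : nat, k' = k + n%:Z.
  by exists `|k' - k|%N; rewrite gez0_abs ?subr_ge0 // addrCA subrr addr0.
rewrite expfzDr ?vq_neq0 // => E.
case: n E => [|n] E; first by rewrite mulr1.
have {E}: p%:F = (p' * 'X^(n.+1))%:F :> {fraction {poly rat}}.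
  apply: (mulIf (expfz_neq0 k vq_neq0)); rewrite E tofracM tofracXn -/vq.
  by rewrite -exprnP mulrCA [RHS]mulrC.
by move/eqP; rewrite tofrac_eq => /eqP pE; rewrite pE coefMXn eqxx in p0.
Qed.

(* Main.v *)
Require Import Defs.
From mathcomp Require Import all_boot all_order all_algebra.
From mathcomp Require Import ring zify.
Set Implicit Arguments.
Unset Strict Implicit.
Unset Printing Implicit Defensive.
Import Order.TTheory GRing.Theory Num.Theory.
Local Open Scope ring_scope.

(** At t = q the operators of the polynomial representation become, on symmetric
    Laurent polynomials and after multiplication by the Weyl denominator
    X - X^{-1}, elements of a quantum torus: its monomials are
    M_(a,c) f (X) = q^{-ac/4} X^a f(q^{-c/2} X), and
    M_u M_v = q^{det(u,v)/4} M_(u+v).  Under this identification X + X^{-1} is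
    M_(1,0) + M_(-1,0), and Y + Y^{-1}, the Macdonald operator, is
    M_(0,1) + M_(0,-1).

    The tau automorphisms are brought in through two elements of the algebra,
    tau_+(Y + Y^{-1}) = tau_-(X + X^{-1}) and
    tau_+^{-1}(Y + Y^{-1}) = tau_-^{-1}(X + X^{-1}).  The two products of
    X + X^{-1} and Y + Y^{-1}, taken in either order, are combinations of these
    two elements ([symX_mul_symY], [symY_mul_symX]), with the coefficients with
    which M_u + M_{-u} and M_v + M_{-v} multiply in the quantum torus when
    det(u,v) = 1 ([tsymM]).  Inverting this linear system shows that precomposing
    a representation with a tau letter changes the pair (u,v) of exponents
    by the corresponding elementary matrix ([slopes_tauP] and its companions).
    By induction on the word, the image of X + X^{-1} acts as
    M_(r,s) + M_(-r,-s), where (r,s) is the first column of the matrix.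

    The character P_b obeys the Chebyshev recurrence in X + X^{-1}, so its image
    acts as the sum of the M_(n(r,s)) over n = b, b-2, ..., -b ([word_macP]).
    Applied to X - X^{-1} at X = q^{-1/2}, this is the sum to be proved
    ([Jsharp_tmac], [tmono_weyl]).

    For the reduced invariant, use
    1 - q^{r+1} - q^{s+1} + q^{r+s} =
      (1 - q^{r+1}) (1 - q^{s+1}) + q^{r+s} (1 - q^2).
    Coprimality makes r or s odd, so 1 - q^2 divides the first product; the
    quotient is a polynomial in q with constant term 1, because r + s > 0
    ([lowest_quotient]). *)

(** * Products of the spherical generators *)

Section Relations.
Variables (F : fieldType) (P : daha_param F).
Local Notation q4 := (q4 P).
Local Notation th := (th P).
Local Notation X := (hX P). Local Notation XV := (hXV P).
Local Notation Y := (hY P). Local Notation YV := (hYV P).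
Local Notation T := (hT P). Local Notation TV := (hTV P).

Definition symX : daha P := X + XV.
Definition symY : daha P := Y + YV.
(** The common value of tau_+ (Y + Y^{-1}) and tau_- (X + X^{-1}). *)
Definition symXY : daha P := q4^-1 *: (X * Y) + q4 *: (YV * XV).
(** The common value of tau_+^{-1} (Y + Y^{-1}) and tau_-^{-1} (X + X^{-1}). *)
Definition symXVY : daha P := q4 *: (XV * Y) + q4^-1 *: (YV * X).

Lemma hTVE : TV = T - (th - th^-1)%:A.
Proof.
have [_ _ _ _ TTV TVT He _ _ _] := hgen_rels P.
rewrite -/T -/TV in TTV TVT He.
apply: (can_inj (g := fun a => TV * a) (f := fun a => T * a)).
  by move=> a; rewrite mulrA TVT mul1r.
rewrite TTV; apply/esym/eqP; rewrite -subr_eq0; apply/eqP; rewrite -[RHS]He.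
rewrite mulrBl !mulrDr !mulrN !mulr_algl !mulr_algr scalerA mulfV ?th_neq0 //.
by rewrite scale1r scalerBl opprB opprD !addrA.
Qed.

Lemma symX_commT : symX * T = T * symX.
Proof.
have [_ _ _ _ TTV TVT _ TXT _ _] := hgen_rels P.
rewrite -/X -/XV -/T -/TV in TTV TVT TXT.
have TXV : TV * XV = X * T by rewrite -TXT !mulrA TVT mul1r.
have XVTV : XV * TV = T * X by rewrite -TXT -[LHS]mulrA TTV mulr1.
rewrite /symX mulrDl mulrDr -TXV -XVTV hTVE mulrBl mulrBr mulr_algl mulr_algr.
by rewrite [LHS]addrAC [RHS]addrAC [X in X - _]addrC.
Qed.

Lemma symY_commT : symY * T = T * symY.
Proof.
have [_ _ _ _ TTV TVT _ _ TYT _] := hgen_rels P.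
rewrite -/Y -/YV -/T -/TV in TTV TVT TYT.
have YVT : YV * T = TV * Y by rewrite -TYT -[LHS]mulrA TVT mulr1.
have TYV : T * YV = Y * TV by rewrite -TYT !mulrA TTV mul1r.
rewrite /symY mulrDl mulrDr YVT TYV hTVE mulrBl mulrBr mulr_algl mulr_algr.
exact: addrCA.
Qed.

(** After replacing Y^{-1} by T^{-1} Y T^{-1} and commuting X + X^{-1} with T^{-1},
    the mixed terms of the product are those that the automorphism relations
    [tau_aux] express through Y^{-1} X^{-1} and Y^{-1} X. *)
Lemma symX_mul_symY : symX * symY = q4 *: symXY + q4^-1 *: symXVY.
Proof.
have [_ _ _ _ TTV TVT _ _ TYT _] := hgen_rels P.
have [E1 E2 _ _] := tau_aux (hgen_rels P); have q0 := q4_neq0 P.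
rewrite -/X -/XV -/Y -/YV -/T -/TV in E1 E2 TTV TVT TYT.
have hxTV : symX * TV = TV * symX.
  rewrite -[LHS]mul1r -TVT mulrA -[TV * T * _]mulrA -symX_commT.
  by rewrite mulrA -mulrA TTV mulr1.
rewrite /symXY /symXVY !scalerDr !scalerA mulfV // mulVf // !scale1r.
rewrite -!expr2.
have -> : q4 ^+ 2 *: (YV * XV) = TV * X * Y * TV by rewrite E1.
have -> : q4^-1 ^+ 2 *: (YV * X) = TV * XV * Y * TV.
  by rewrite -E2 scalerA -exprMn mulVf // expr1n scale1r.
rewrite [symY]/symY mulrDr -TYT !mulrA hxTV /symX.
rewrite mulrDr !mulrDl -!addrA; congr (_ + _).
exact: addrCA.
Qed.

(** The two sides are the images of Y + Y^{-1} under tau_+ and of X + X^{-1} under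
    tau_-.  Both reduce to a multiple of Y X + T Y X T; the quadratic relation of
    T accounts for the different positions of the factors T. *)
Lemma symXY_YX : symXY = q4 *: (Y * X) + q4^-1 *: (XV * YV).
Proof.
have [XXV XVX YYV YVY TTV TVT _ _ _ YXYX] := hgen_rels P.
have [E1 _ E3 _] := tau_aux (hgen_rels P); have q0 := q4_neq0 P.
rewrite -/X -/XV -/Y -/YV -/T -/TV in E1 E3 TTV TVT XXV XVX YYV YVY YXYX.
have XY : X * Y = q4 ^+ 2 *: (Y * X * T * T).
  have := congr1 (fun a => X * Y * a) YXYX.
  rewrite mulr1 mulr_algr -scalerAr expr2 !mulrA => <-; congr (_ *: _).
  by rewrite -[X * Y * YV]mulrA YYV mulr1 XXV mul1r.
have q4q2 : q4^-1 * q4 ^+ 2 = q4 by rewrite expr2 mulrA mulVf // mul1r.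
have -> : symXY = q4^-1 *: (X * Y + TV * X * Y * TV).
  by rewrite E1 /symXY scalerDr scalerA q4q2.
have -> : q4^-1 *: (XV * YV) = q4 *: (T * Y * X * T).
  by rewrite -E3 scalerA q4q2.
rewrite -[TV * X * Y]mulrA XY -scalerAr -scalerAl -scalerDr scalerA q4q2.
rewrite -scalerDr; congr (_ *: _).
rewrite !mulrA -[_ * T * TV]mulrA TTV mulr1 hTVE.
rewrite !(mulrBl, mulr_algl) -!scalerAl addrCA.
rewrite [RHS]addrC; congr (_ + _).
by rewrite -mulr_algr -mulrBr -hTVE -[LHS]mulrA TTV mulr1.
Qed.

(** Same argument as for [symX_mul_symY], with the two generators exchanged and
    T in place of T^{-1}. *)
Lemma symY_mul_symX : symY * symX = q4^-1 *: symXY + q4 *: symXVY.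
Proof.
have [_ _ _ _ _ _ _ TXT _ _] := hgen_rels P.
have [_ _ E3 E4] := tau_aux (hgen_rels P); have q0 := q4_neq0 P.
rewrite -/X -/XV -/Y -/YV -/T in E3 E4 TXT.
rewrite symXY_YX /symXVY !scalerDr !scalerA mulfV // mulVf // !scale1r.
rewrite -!expr2.
have -> : q4 ^+ 2 *: (XV * Y) = T * YV * X * T by rewrite E4.
have -> : q4^-1 ^+ 2 *: (XV * YV) = T * Y * X * T.
  by rewrite -E3 scalerA -exprMn mulVf // expr1n scale1r.
rewrite [symX]/symX mulrDr -TXT !mulrA symY_commT /symY.
rewrite mulrDr !mulrDl -!addrA; congr (_ + _).
by rewrite addrC -addrA.
Qed.

Lemma tauP_symX : tauP P symX = symX.
Proof. by rewrite rmorphD /= !tauP_hgen. Qed.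
Lemma tauP_symY : tauP P symY = symXY.
Proof. by rewrite rmorphD /= !tauP_hgen. Qed.
Lemma tauPV_symX : tauPV P symX = symX.
Proof. by rewrite rmorphD /= !tauPV_hgen. Qed.
Lemma tauPV_symY : tauPV P symY = symXVY.
Proof. by rewrite rmorphD /= !tauPV_hgen. Qed.
Lemma tauM_symX : tauM P symX = symXY.
Proof. by rewrite rmorphD /= !tauM_hgen symXY_YX. Qed.
Lemma tauM_symY : tauM P symY = symY.
Proof. by rewrite rmorphD /= !tauM_hgen. Qed.
Lemma tauMV_symX : tauMV P symX = symXVY.
Proof. by rewrite rmorphD /= !tauMV_hgen addrC. Qed.
Lemma tauMV_symY : tauMV P symY = symY.
Proof. by rewrite rmorphD /= !tauMV_hgen. Qed.
End Relations.

(** * Evaluation of Laurent polynomials, and the quantum torus *)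

Section Evaluation.
Variables (F : fieldType) (u : F).
Hypothesis u0 : u != 0.
Local Notation V := (laurent F).

Let uV : (u : F^o) * (u^-1 : F^o) = 1. Proof. exact: mulfV. Qed.

Lemma levalB (f g : V) : leval u (f - g) = leval u f - leval u g.
Proof. exact: (lsubst_zmod_morphism uV). Qed.
Lemma levalD (f g : V) : leval u (f + g) = leval u f + leval u g.
Proof. by apply/eqP; rewrite -subr_eq -levalB addrK. Qed.
Lemma levalN (f : V) : leval u (- f) = - leval u f.
Proof. by rewrite -[RHS]sub0r -(subrr (leval u f)) -levalB subrr -levalB sub0r. Qed.
Lemma levalM (f g : V) : leval u (f * g) = leval u f * leval u g.
Proof. exact: (lsubst_monoid_morphism uV).2. Qed.
Lemma leval1 : leval u 1 = 1.
Proof. exact: (lsubst_monoid_morphism uV).1. Qed.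
Lemma levalZ c (f : V) : leval u (c *: f) = c * leval u f.
Proof. exact: (lsubst_scale uV). Qed.
Lemma levalX : leval u (lX F) = u.
Proof. exact: (lsubst_X uV). Qed.
Lemma levalXV : leval u (lXV F) = u^-1.
Proof. exact: (lsubst_XV uV). Qed.
Lemma levalXn n (f : V) : leval u (f ^+ n) = leval u f ^+ n.
Proof. by elim: n => [|n IH]; rewrite ?leval1 // !exprS levalM IH. Qed.
End Evaluation.

Lemma leval_lsubst (F : fieldType) (u : F) (a b f : laurent F) :
  u != 0 -> a * b = 1 -> leval u (lsubst a b f) = leval (leval u a) f.
Proof.
move=> u0 ab; set v := leval u a.
have vb : v * leval u b = 1 by rewrite -levalM // ab leval1.
have v0 : v != 0 by apply: contra_eqN vb => /eqP->; rewrite mul0r eq_sym oner_eq0.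
have vV : leval u b = v^-1 by apply: (mulfI v0); rewrite vb mulfV.
elim/laurent_ind: f => [f g Ef Eg|c f Ef|n|n].
- have -> : lsubst a b (f + g) = lsubst a b f + lsubst a b g.
    by apply/eqP; rewrite -subr_eq -(lsubst_zmod_morphism ab) addrK.
  by rewrite !levalD // Ef Eg.
- by rewrite (lsubst_scale ab) !levalZ // Ef.
- have -> : lsubst a b (lX F ^+ n) = a ^+ n.
    elim: n => [|n IH]; first exact: (lsubst_monoid_morphism ab).1.
    by rewrite !exprS (lsubst_monoid_morphism ab).2 IH lsubst_X.
  by rewrite !levalXn // levalX.
- have -> : lsubst a b (lXV F ^+ n) = b ^+ n.
    elim: n => [|n IH]; first exact: (lsubst_monoid_morphism ab).1.
    by rewrite !exprS (lsubst_monoid_morphism ab).2 IH lsubst_XV.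
  by rewrite !levalXn // levalXV // vV.
Qed.

Section Operators.
Variables (F : fieldType) (P : daha_param F).
Local Notation q4 := (q4 P).
Local Notation th := (th P).

Lemma leval_linv (u : F) f : u != 0 -> leval u (linv f) = leval u^-1 f.
Proof. by move=> u0; rewrite leval_lsubst ?lXVX // levalXV. Qed.

Lemma leval_oppi (u : F) f : u != 0 ->
  leval u (oppi P f) = leval (q4 ^+ 2 / u) f.
Proof.
move=> u0; rewrite [leval u _]leval_lsubst //.
  by rewrite levalZ // levalXV.
by rewrite -scalerAl -scalerAr lXVX scalerA divff ?scale1r // expf_neq0 // q4_neq0.
Qed.

(** The factor u^2 - 1 clears the denominator of the divided difference in T, so
    that the formula also holds at u = 1 and u = -1. *)
Lemma leval_opT (u : F) f : u != 0 ->
  (u ^+ 2 - 1) * leval u (opT P f) =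
  (u ^+ 2 - 1) * (th * leval u^-1 f) + (th - th^-1) * (leval u^-1 f - leval u f).
Proof.
move=> u0; rewrite opTE levalD // !levalZ // leval_linv //.
rewrite mulrDr; congr (_ + _); rewrite mulrCA; congr (_ * _).
have := congr1 (leval u) (ldiffE f).
by rewrite levalM // !levalB // levalXn // levalX // leval1 // leval_linv.
Qed.

Lemma poly_rep_hXV f : poly_rep P (hXV P) f = lXV F * f.
Proof. by rewrite [poly_rep _ _]hlift_gen. Qed.
Lemma poly_rep_hYV f :
  poly_rep P (hYV P) f = opT P (oppi P f) - (th - th^-1) *: oppi P f.
Proof. by rewrite [poly_rep _ _]hlift_gen. Qed.
End Operators.

Lemma pair_mulrz (a : int * int) (c : int) : a *~ c = (c * a.1, c * a.2).
Proof.
rewrite [a *~ c]surjective_pairing.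
by rewrite (raddfMz (@fst int int)) (raddfMz (@snd int int)) !mulrzz ![_ * c]mulrC.
Qed.

Section QuantumTorus.
Variables (F : fieldType) (v : F).
Hypothesis v0 : v != 0.
Implicit Types (G : int -> F) (a b : int * int).

(** The monomial M_a of the quantum torus, acting on functions of the exponent n
    of a point X = v^n: with v = q^{1/4} it multiplies by q^{-a1 a2/4} X^{a1} after
    the shift X -> q^{-a2/2} X. *)
Definition tmono a G : int -> F :=
  fun n => v ^ (n * a.1 - a.1 * a.2) * G (n - 2 * a.2).
Definition tsym a G : int -> F := fun n => tmono a G n + tmono (- a) G n.
Definition det2 a b : int := a.1 * b.2 - a.2 * b.1.

Lemma tmonoM a b G n :
  tmono a (tmono b G) n = v ^ det2 a b * tmono (a + b) G n.
Proof.
rewrite /tmono !mulrA -!expfzDr // /det2 /=; congr (_ ^ _ * G _); ring.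
Qed.

Lemma tmonoD a G H n : tmono a (fun m => G m + H m) n = tmono a G n + tmono a H n.
Proof. exact: mulrDr. Qed.

Lemma eq_tmono a G H : G =1 H -> tmono a G =1 tmono a H.
Proof. by move=> GH n; rewrite /tmono GH. Qed.
Lemma eq_tsym a G H : G =1 H -> tsym a G =1 tsym a H.
Proof. by move=> GH n; rewrite /tsym !(eq_tmono _ GH). Qed.

Lemma tsymN a G n : tsym (- a) G n = tsym a G n.
Proof. by rewrite /tsym opprK addrC. Qed.

Lemma tsymM a b G n : tsym a (tsym b G) n =
  v ^ det2 a b * tsym (a + b) G n + v ^ (- det2 a b) * tsym (a - b) G n.
Proof.
rewrite {1}/tsym !tmonoD !tmonoM /tsym.
have -> : det2 a (- b) = - det2 a b by rewrite /det2 /=; ring.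
have -> : det2 (- a) b = - det2 a b by rewrite /det2 /=; ring.
have -> : det2 (- a) (- b) = det2 a b by rewrite /det2 /=; ring.
rewrite !opprD !opprK; ring.
Qed.

(** The character P_k with M_a substituted for X, since M_a^n = M_(na). *)
Definition tmac (k : nat) a G : int -> F :=
  fun n => \sum_(i < k.+1) tmono (a *~ (k%:Z - 2 * i%:Z)) G n.

Lemma tmac0 a G n : tmac 0 a G n = G n.
Proof.
rewrite /tmac big_ord1 mulr0 subrr mulr0z /tmono /=.
by rewrite !mulr0 !subr0 mul1r.
Qed.

Lemma tmac1 a G n : tmac 1 a G n = tsym a G n.
Proof.
by rewrite /tmac big_ord_recr big_ord1 /= mulr0 subr0 mulr1z mulr1 mulrN1z.
Qed.

(** Multiplication by M_a + M_{-a} shifts the string of exponents up and down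
    by one; the extreme term of the lower string completes the upper one. *)
Lemma tmac_rec k a G n :
  tsym a (tmac k.+1 a G) n = tmac k.+2 a G n + tmac k a G n.
Proof.
(* Multiples of a have determinant 0, so no power of v appears. *)
have E (c : int) (i : 'I_k.+2) :
    tmono (a *~ c) (tmono (a *~ (k.+1%:Z - 2 * i%:Z)) G) n =
    tmono (a *~ (k.+1%:Z + c - 2 * i%:Z)) G n.
  rewrite tmonoM -mulrzDr /det2.
  rewrite (_ : _ - _ = 0) ?mul1r; last first.
    by rewrite !pair_mulrz /=; ring.
  by congr (tmono (a *~ _) G n); ring.
have lin (c : int) : tmono (a *~ c) (tmac k.+1 a G) n =
    \sum_(i < k.+2) tmono (a *~ (k.+1%:Z + c - 2 * i%:Z)) G n.
  rewrite {1}/tmono /tmac mulr_sumr.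
  by apply: eq_bigr => i _; rewrite -E.
have := lin 1; have := lin (-1); rewrite mulr1z mulrN1z /tsym => -> ->.
rewrite [X in _ + X]big_ord_recr [tmac k.+2 _ _ _]big_ord_recr /=.
rewrite -!addrA; congr (_ + _).
  by apply: eq_bigr => i _; congr (tmono (a *~ _) G n); lia.
rewrite addrC; congr (_ + _).
  by congr (tmono (a *~ _) G n); lia.
by apply: eq_bigr => i _; congr (tmono (a *~ _) G n); lia.
Qed.
End QuantumTorus.

Lemma macP_rec (R : nzRingType) k (x xV : R) : x * xV = 1 -> xV * x = 1 ->
  (x + xV) * macP k.+1 x xV = macP k.+2 x xV + macP k x xV.
Proof.
move=> xxV xVx; rewrite mulrDl.
have -> : macP k.+2 x xV = x * macP k.+1 x xV + xV ^+ k.+2.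
  rewrite /macP big_ord_recr /= subnn mul1r; congr (_ + _).
  rewrite mulr_sumr; apply: eq_bigr => i _.
  by rewrite mulrA -exprS -subSn // -ltnS.
rewrite -addrA; congr (_ + _).
rewrite /macP mulr_sumr big_ord_recr /= subnn mul1r -exprS addrC; congr (_ + _).
apply: eq_bigr => i _; rewrite subSn -1?ltnS // exprS !mulrA.
by rewrite xVx mul1r.
Qed.

(** * The quantum torus action on symmetric Laurent polynomials *)

Lemma lend0r (F : fieldType) (A : lend F) : A 0 = 0.
Proof. by apply: (addrI (A 0)); rewrite -lend_add !addr0. Qed.
Lemma lend_scale (F : fieldType) (A : lend F) c f : A (c *: f) = c *: A f.
Proof. by rewrite -[c *: f]addr0 lend_linear lend0r addr0. Qed.

Section Action.
Variables (F : fieldType) (P : daha_param F).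
Local Notation q4 := (q4 P).
Local Notation th := (th P).
Hypothesis thE : th = q4 ^+ 2.
Hypothesis q4_free : forall n : int, q4 ^ n = 1 -> n = 0.

Let q0 : q4 != 0 := q4_neq0 P.
Let qz n : q4 ^ (n : int) != 0. Proof. exact: expfz_neq0. Qed.

(** Symmetric Laurent polynomials, as an eigenspace of T: in this form the
    property is visibly preserved by the operators that commute with T. *)
Definition symm (f : laurent F) := opT P f = th *: f.

(** The values at X = q^{n/4} of f multiplied by the Weyl denominator
    X - X^{-1}; this twist turns the Macdonald operator at t = q into a plain
    sum of two shifts. *)
Definition dval (f : laurent F) (n : int) : F :=
  (q4 ^ n - q4 ^ (- n)) * leval (q4 ^ n) f.

Lemma dvalD f g n : dval (f + g) n = dval f n + dval g n.
Proof. by rewrite /dval levalD // mulrDr. Qed.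
Lemma dvalB f g n : dval (f - g) n = dval f n - dval g n.
Proof. by rewrite /dval levalB // mulrBr. Qed.
Lemma dvalZ c f n : dval (c *: f) n = c * dval f n.
Proof. by rewrite /dval levalZ // mulrCA. Qed.

Lemma symmD c f g : symm f -> symm g -> symm (c *: f + g).
Proof.
by rewrite /symm => Ef Eg; rewrite lend_linear Ef Eg scalerDr !scalerA mulrC.
Qed.

Lemma symm0 : symm 0.
Proof. by rewrite /symm lend0r scaler0. Qed.

Lemma symm1 : symm 1.
Proof.
rewrite /symm opTE linv1 -[RHS]addr0; congr (_ + _).
suff -> : ldiff (1 : laurent F) = 0 by rewrite scaler0.
apply: lval_inj; rewrite -[LHS]/((lval (linv 1) - lval 1) / _).
by rewrite linv1 subrr mul0r.
Qed.

(** The eigenvalue equation forces equality wherever t X^2 differs from 1.  The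
    only excluded exponent is n = -2, where the equality is the one at n = 2. *)
Lemma symm_leval f n : symm f -> leval (q4 ^ n) f = leval (q4 ^ (- n)) f.
Proof.
move=> fS; wlog n2 : n / n != -2 => [W|].
  have [->|/W//] := eqVneq n (-2).
  by apply/esym; rewrite -{2}[-2]opprK; apply: W.
have := leval_opT P f (qz n); rewrite fS levalZ // invr_expz => E.
have {E} : (q4 ^ (2 * n + 4) - 1) * (leval (q4 ^ (- n)) f - leval (q4 ^ n) f) = 0.
  have q2n : q4 ^ (2 * n + 4) = th ^+ 2 * (q4 ^ n) ^+ 2.
    by rewrite thE -exprM expfzDr // mulrC (mulrC 2) -exprz_exp.
  have th0 := th_neq0 P; rewrite q2n.
  transitivity (th * (((q4 ^ n) ^+ 2 - 1) * (th * leval (q4 ^ (- n)) f) +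
    (th - th^-1) * (leval (q4 ^ (- n)) f - leval (q4 ^ n) f) -
    ((q4 ^ n) ^+ 2 - 1) * (th * leval (q4 ^ n) f))); first by field.
  by rewrite -E subrr mulr0.
move/eqP; rewrite mulf_eq0 !subr_eq0 => /orP[/eqP/q4_free|/eqP-> //]; lia.
Qed.

(** Stability of the symmetric Laurent polynomials is part of the definition
    so that such operators can be composed. *)
Definition acts_as (A : lend F) (a : int * int) := forall f, symm f ->
  symm (A f) /\ dval (A f) =1 tsym q4 a (dval f).

(** The exponents of the quantum torus elements by which a representation lets
    X + X^{-1} and Y + Y^{-1} act.  They form the columns of a matrix of
    determinant 1, which the tau letters multiply on the right. *)
Definition slopes (rho : {lrmorphism daha P -> lend F}) (a b : int * int) :=
  [/\ acts_as (rho (symX P)) a, acts_as (rho (symY P)) b & det2 a b = 1].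

Lemma acts_comb A B C a b c k l : acts_as A a -> acts_as B b ->
  (forall F n, k * tsym q4 a (tsym q4 b F) n + l * tsym q4 b (tsym q4 a F) n =
     tsym q4 c F n) ->
  C = k *: (A * B) + l *: (B * A) -> acts_as C c.
Proof.
move=> hA hB E -> f fS.
have [[AS Af] [BS Bf]] := (hA f fS, hB f fS).
have [[BAS BAf] [ABS ABf]] := (hB _ AS, hA _ BS).
split=> [|n].
  have -> : (k *: (A * B) + l *: (B * A)) f = k *: A (B f) + (l *: B (A f) + 0).
    by rewrite addr0.
  by apply: symmD => //; apply: symmD => //; apply: symm0.
rewrite lendDE !lendZE !lendME dvalD !dvalZ ABf BAf.
by rewrite (eq_tsym _ _ Bf) (eq_tsym _ _ Af) E.
Qed.

Lemma th_subV_neq0 : th - th^-1 != 0.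
Proof.
apply/eqP => /(congr1 (fun c => c * th)).
rewrite mulrBl mulVf ?th_neq0 // mul0r => /eqP; rewrite subr_eq0 thE -exprD.
by move/eqP/(@q4_free 4).
Qed.

(** Inverts the linear system [symX_mul_symY], [symY_mul_symX]; its determinant
    is q^{1/2} - q^{-1/2}, and this is t^{1/2} - t^{-1/2} at t = q. *)
Lemma symXY_comb : symXY P = (q4 / (th - th^-1)) *: (symX P * symY P) -
  (q4^-1 / (th - th^-1)) *: (symY P * symX P).
Proof.
have c0 := th_subV_neq0; apply: (scalerI c0).
rewrite scalerBr !scalerA !(mulrCA (th - th^-1)) !divff // !mulr1.
rewrite symX_mul_symY symY_mul_symX; move: (symXY P) (symXVY P) => z zV; rewrite !scalerDr !scalerA.
rewrite opprD addrACA -!scalerBl mulfV // mulVf // subrr scale0r addr0.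
by rewrite thE expr2 invfM.
Qed.

Lemma symXVY_comb : symXVY P = (q4 / (th - th^-1)) *: (symY P * symX P) -
  (q4^-1 / (th - th^-1)) *: (symX P * symY P).
Proof.
have c0 := th_subV_neq0; apply: (scalerI c0).
rewrite scalerBr !scalerA !(mulrCA (th - th^-1)) !divff // !mulr1.
rewrite symX_mul_symY symY_mul_symX; move: (symXY P) (symXVY P) => z zV; rewrite !scalerDr !scalerA.
rewrite opprD addrACA -!scalerBl mulfV // mulVf // subrr scale0r add0r.
by rewrite thE expr2 invfM.
Qed.

Lemma det2C a b : det2 a b = - det2 b a.
Proof. rewrite /det2; ring. Qed.

Lemma acts_coef S D : q4 / (th - th^-1) * (q4 * S + q4^-1 * D) +
  - (q4^-1 / (th - th^-1)) * (q4^-1 * S + q4 * D) = S.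
Proof.
have c0 := th_subV_neq0.
transitivity ((q4 ^+ 2 - (q4 ^+ 2)^-1) / (th - th^-1) * S).
  by move: (th - th^-1) c0 => c c0; field; rewrite ?c0 ?q0.
by rewrite -thE divff ?mul1r.
Qed.

Section Slopes.
Variables (rho : {lrmorphism daha P -> lend F}) (a b : int * int).
Hypothesis rhoP : slopes rho a b.

Lemma acts_symXY : acts_as (rho (symXY P)) (a + b).
Proof.
have [ra rb ab] := rhoP.
apply: (acts_comb ra rb (k := q4 / (th - th^-1)) (l := - (q4^-1 / (th - th^-1)))).
  move=> G n; rewrite !tsymM // (det2C b) ab (addrC b) -(tsymN _ (b - a)) opprB.
  rewrite !opprK !expr1z -exprN1; exact: acts_coef.
by rewrite symXY_comb raddfB /= !linearZ !rmorphM /= scaleNr scalerN.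
Qed.

Lemma acts_symXVY : acts_as (rho (symXVY P)) (b - a).
Proof.
have [ra rb ab] := rhoP.
apply: (acts_comb rb ra (k := q4 / (th - th^-1)) (l := - (q4^-1 / (th - th^-1)))).
  move=> G n; rewrite !tsymM // (det2C b) ab (addrC b) -(tsymN _ (b - a)) opprB.
  rewrite !opprK !expr1z -exprN1 ![_ + _ * tsym q4 (a - b) G n]addrC.
  exact: acts_coef.
by rewrite symXVY_comb raddfB /= !linearZ !rmorphM /= scaleNr scalerN.
Qed.
End Slopes.

Section Twists.
Variables (rho : {lrmorphism daha P -> lend F}) (a b : int * int).
Hypothesis rhoP : slopes rho a b.
Let ra : acts_as (rho (symX P)) a. Proof. by case: rhoP. Qed.
Let rb : acts_as (rho (symY P)) b. Proof. by case: rhoP. Qed.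
Let ab : det2 a b = 1. Proof. by case: rhoP. Qed.

Lemma slopes_tauP : slopes (rho \o tauP P) a (a + b).
Proof.
split=> /=; rewrite ?tauP_symX ?tauP_symY //; first exact: acts_symXY rhoP.
by rewrite -ab /det2 /=; ring.
Qed.
Lemma slopes_tauPV : slopes (rho \o tauPV P) a (b - a).
Proof.
split=> /=; rewrite ?tauPV_symX ?tauPV_symY //; first exact: acts_symXVY rhoP.
by rewrite -ab /det2 /=; ring.
Qed.
Lemma slopes_tauM : slopes (rho \o tauM P) (a + b) b.
Proof.
split=> /=; rewrite ?tauM_symX ?tauM_symY //; first exact: acts_symXY rhoP.
by rewrite -ab /det2 /=; ring.
Qed.
Lemma slopes_tauMV : slopes (rho \o tauMV P) (a - b) b.
Proof.
split=> /=; rewrite ?tauMV_symX ?tauMV_symY //.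
  by move=> f fS; have [? E] := acts_symXVY rhoP fS; split=> // n; rewrite E -tsymN opprB.
by rewrite -ab /det2 /=; ring.
Qed.
End Twists.

(** For Y + Y^{-1}, with g = pi f one has Y f = t^{1/2} g and
    Y^{-1} f = T g - (t^{1/2} - t^{-1/2}) g.  The values of g at X and X^{-1} are
    those of f at q^{-1/2} X and q^{1/2} X, and for t = q their coefficients are
    the Weyl denominators at these two points, divided by that at X. *)
Lemma slopes_poly_rep : slopes (poly_rep P) (1, 0) (0, 1).
Proof.
split=> // [f fS|f fS]; split.
- rewrite /symm -!poly_rep_hT -lendME -rmorphM -symX_commT rmorphM lendME.
  by rewrite poly_rep_hT fS lend_scale.
- move=> n; rewrite rmorphD lendDE poly_rep_hX poly_rep_hXV dvalD.
  rewrite /dval !levalM // levalX // levalXV // /tsym /tmono /=.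
  rewrite !mulr0 !subr0 !mulr1 mulrN1 -invr_expz; ring.
- rewrite /symm -!poly_rep_hT -lendME -rmorphM -symY_commT rmorphM lendME.
  by rewrite poly_rep_hT fS lend_scale.
- move=> n; rewrite rmorphD lendDE poly_rep_hY poly_rep_hYV fS.
  rewrite lend_scale; set g := oppi P f.
  have gA : leval (q4 ^ n) g = leval (q4 ^ (n - 2)) f.
    rewrite leval_oppi // (symm_leval _ fS) opprB expfzDr //.
    by rewrite -invr_expz.
  have gB : leval (q4 ^ n)^-1 g = leval (q4 ^ (n + 2)) f.
    by rewrite leval_oppi ?invr_neq0 // invrK expfzDr // mulrC.
  move: (leval_opT P g (qz n)); move: (opT P g) => h; rewrite gA gB => E.
  rewrite /dval !levalD // levalN // !levalZ // gA.
  rewrite /tsym /tmono /= !mul0r !mulr0 !subr0 !mul1r mulr1 mulrN1 opprK.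
  move: (leval _ f) (leval _ f) (leval _ h) E => A B C E.
  have e2 : q4 ^ (n + 2) = q4 ^ n * q4 ^+ 2 by rewrite expfzDr.
  have e1 : q4 ^ (n - 2) = q4 ^ n / q4 ^+ 2 by rewrite expfzDr // -invr_expz.
  rewrite -!invr_expz e1 e2.
  move: (q4 ^ n) (qz n) E => u u0 E.
  transitivity (u^-1 * ((u ^+ 2 - 1) * C + (u ^+ 2 - 1) * (th^-1 * A))).
    by field; rewrite u0 th_neq0.
  rewrite E thE; field; by rewrite u0 q0.
Qed.

End Action.

(** * Words in the tau letters *)

Lemma mx22_mul_col0 (a b c d : int) (M : 'M[int]_2) :
  (mx22 a b c d *m M) 0 0 = a * M 0 0 + b * M 1 0 /\
  (mx22 a b c d *m M) 1 0 = c * M 0 0 + d * M 1 0.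
Proof.
have E (i : 'I_2) : (mx22 a b c d *m M) i 0 =
    mx22 a b c d i 0 * M 0 0 + mx22 a b c d i 1 * M 1 0.
  rewrite mxE !big_ord_recl big_ord0 addr0.
  by rewrite (_ : lift ord0 ord0 = 1) //; apply: val_inj.
by rewrite !E !mxE.
Qed.

Section Words.
Variables (F : fieldType) (P : daha_param F).
Local Notation q4 := (q4 P).
Local Notation th := (th P).
Hypothesis thE : th = q4 ^+ 2.
Hypothesis q4_free : forall n : int, q4 ^ n = 1 -> n = 0.

Lemma slopes_macP (rho : {lrmorphism daha P -> lend F}) a b k f :
  slopes rho a b -> symm P f ->
  symm P (rho (macP k (hX P) (hXV P)) f) /\
  dval P (rho (macP k (hX P) (hXV P)) f) =1 tmac q4 k a (dval P f).
Proof.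
move=> [ra _ _] fS.
have [XXV XVX _ _ _ _ _ _ _ _] := hgen_rels P.
pose Q k := symm P (rho (macP k (hX P) (hXV P)) f) /\
  dval P (rho (macP k (hX P) (hXV P)) f) =1 tmac q4 k a (dval P f).
(* The recurrence has two steps. *)
suff: Q k /\ Q k.+1 by case.
elim: k => [|k [[S0 E0] [S1 E1]]]; last split=> //.
  split; rewrite /Q /macP.
    by rewrite big_ord1 mul1r rmorph1 lend1E; split=> // n; rewrite tmac0.
  rewrite big_ord_recr big_ord1 /= mul1r mulr1 !expr1.
  by have [S E] := ra f fS; split=> // n; rewrite E tmac1.
have E : rho (macP k.+2 (hX P) (hXV P)) f =
    rho (symX P) (rho (macP k.+1 (hX P) (hXV P)) f) +
    (-1) *: (rho (macP k (hX P) (hXV P)) f).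
  have := macP_rec k XXV XVX; rewrite -/(hX P) -/(hXV P).
  move=> /esym/(canRL (addrK _)) ->.
  by rewrite rmorphB rmorphM scaleN1r.
have [S2 E2] := ra _ S1.
split; rewrite E; first by rewrite addrC; apply: symmD.
move=> n; rewrite scaleN1r dvalB E2 (eq_tsym _ _ E1) E0 tmac_rec ?addrK //.
exact: q4_neq0.
Qed.

(** Induction on the word with the representation generalized: the first letter
    is absorbed into the representation, which changes its slopes. *)
Lemma word_macP w (rho : {lrmorphism daha P -> lend F}) a b k f :
  slopes rho a b -> symm P f ->
  dval P (rho (word_aut w (macP k (hX P) (hXV P))) f) =1
  tmac q4 k (a *~ word_mx w 0 0 + b *~ word_mx w 1 0) (dval P f).
Proof.
move=> + fS; elim: w rho a b => [|l w IH] rho a b rhoP.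
  by rewrite /= !mxE mulr1z mulr0z addr0; apply: (slopes_macP k rhoP fS).2.
have mxE2 := mx22_mul_col0.
rewrite [word_mx _]/(letter_mx l *m word_mx w); case: l; rewrite ?letter_mxPV ?letter_mxMV.
- have [-> ->] := mxE2 1 1 0 1 (word_mx w) => n.
  rewrite [LHS](IH _ _ _ (slopes_tauP thE q4_free rhoP)).
  by congr (tmac _ _ _ _ _); rewrite !pair_mulrz /=; congr (_, _) => /=; ring.
- have [-> ->] := mxE2 1 (-1) 0 1 (word_mx w) => n.
  rewrite [LHS](IH _ _ _ (slopes_tauPV thE q4_free rhoP)).
  by congr (tmac _ _ _ _ _); rewrite !pair_mulrz /=; congr (_, _) => /=; ring.
- have [-> ->] := mxE2 1 0 1 1 (word_mx w) => n.
  rewrite [LHS](IH _ _ _ (slopes_tauM thE q4_free rhoP)).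
  by congr (tmac _ _ _ _ _); rewrite !pair_mulrz /=; congr (_, _) => /=; ring.
- have [-> ->] := mxE2 1 0 (-1) 1 (word_mx w) => n.
  rewrite [LHS](IH _ _ _ (slopes_tauMV thE q4_free rhoP)).
  by congr (tmac _ _ _ _ _); rewrite !pair_mulrz /=; congr (_, _) => /=; ring.
Qed.

Lemma Jsharp_tmac w k :
  (q4 ^ (-2) - q4 ^ 2) * Jsharp P w k =
  tmac q4 k (word_mx w 0 0, word_mx w 1 0) (fun n => q4 ^ n - q4 ^ (- n)) (-2).
Proof.
have := word_macP w k (slopes_poly_rep thE q4_free) (symm1 P) (-2).
rewrite {1}/dval /Jsharp /daha_ev thE -[q4 ^- 2]/(q4 ^ (-2)) => ->.
rewrite /tmac; apply: eq_bigr => i _; rewrite !pair_mulrz /= !mulr1 !mulr0 addr0 add0r.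
rewrite /tmono /dval leval1 ?mulr1 //; apply: expfz_neq0; exact: q4_neq0.
Qed.
End Words.

Lemma vq_free (n : int) : vq ^ n = 1 -> n = 0.
Proof.
have pos (k : nat) : vq ^+ k = 1 -> k = 0%N.
  rewrite -tofracXn -tofrac1 => /eqP; rewrite tofrac_eq => /eqP.
  by case: k => // k /(congr1 (fun p : {poly rat} => p.[0])); rewrite hornerXn hornerC expr0n => /eqP.
case: n => k; rewrite ?NegzE; first by move/pos->.
by rewrite -invr_expz => /(canRL (@invrK _)); rewrite invr1 => /pos.
Qed.

(** * The invariants at t = q *)

Lemma qpowE (n : int) x : 4 * x = n%:~R -> qpow x = vq ^ n.
Proof. by rewrite /qpow => ->; rewrite numq_int. Qed.

Lemma vq_neq1 (n : int) : n != 0 -> 1 - vq ^ n != 0.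
Proof. by move=> n0; rewrite subr_eq0; apply: contra_neqN n0 => /eqP/esym/vq_free. Qed.

Section Values.
Variables (F : fieldType) (v : F).
Hypothesis v0 : v != 0.
Local Notation weyl := (fun n : int => v ^ n - v ^ (- n)).

(** The summand with p = j / 2 in the closed formula. *)
Lemma tmono_weyl (r s j : int) :
  tmono v ((r, s) *~ - j) weyl (-2) =
  v ^ (- (r * s * j ^+ 2)) *
  (v ^ (2 * (r + s) * j - 2) - v ^ (2 * (r - s) * j + 2)).
Proof.
rewrite /tmono pair_mulrz /= !mulrBr -!expfzDr //.
congr (v ^ _ - v ^ _); ring.
Qed.

Lemma subV_factor : v ^ (-2) - v ^ 2 = v ^ (-2) * (1 - v ^ 4).
Proof. by rewrite mulrBr mulr1 -expfzDr. Qed.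

Lemma tsym_weyl (r s : int) : 1 - v ^ 4 != 0 ->
  tsym v (r, s) weyl (-2) =
  (v ^ (-2) - v ^ 2) * (v ^ (- (r * s) - 2 * (r + s)) / (1 - v ^ 4) *
    (1 - v ^ (4 * (r + 1)) - v ^ (4 * (s + 1)) + v ^ (4 * (r + s)))).
Proof.
move=> v1; rewrite subV_factor [_ / _ * _]mulrAC.
rewrite -[RHS]mulrA [_ * (_ / _)]mulrCA divff // mulr1.
rewrite /tsym /tmono /=.
set R := v ^ (4 * (r + 1)); set S := v ^ (4 * (s + 1)).
rewrite (_ : 1 - R - S + v ^ (4 * (r + s)) = 1 - S + (v ^ (4 * (r + s)) - R)); last by ring.
rewrite /R /S [RHS]mulrA -expfzDr // [RHS]mulrDr !mulrBr mulr1 -!expfzDr //.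
congr (v ^ _ - v ^ _ + (v ^ _ - v ^ _)); ring.
Qed.

Lemma leval_macP1 :
  leval (v ^ (-2)) (macP 1 (lX F) (lXV F)) = v ^ (-2) * (1 + v ^ 4).
Proof.
have u0 : v ^ (-2) != 0 by rewrite expfz_neq0.
rewrite /macP big_ord_recr big_ord1 /= mul1r mulr1 !expr1 levalD // levalX //.
by rewrite levalXV // invr_expz mulrDr mulr1 -expfzDr.
Qed.

Lemma reduce_quotient (e : int) N : 1 - v ^ 8 != 0 ->
  v ^ e / (1 - v ^ 4) * N / (v ^ (-2) * (1 + v ^ 4)) =
  v ^ (e + 2) * (N / (1 - v ^ 8)).
Proof.
have -> : 1 - v ^ 8 = (1 - v ^ 4) * (1 + v ^ 4).
  by rewrite mulrDr mulr1 mulrBl mul1r -expfzDr // addrA subrK.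
rewrite mulf_eq0 negb_or => /andP[n1 n2]; rewrite expfzDr // -[v ^ (-2)]invr_expz.
have := expfz_neq0 2 v0; move: (v ^ 4) (v ^ 2) n1 n2 => x y n1 n2 y0.
by field; rewrite n1 n2.
Qed.

Lemma knot_factor_nat (m n : nat) :
  1 - v ^ (4 * (m%:Z + 1)) - v ^ (4 * (n%:Z + 1)) + v ^ (4 * (m%:Z + n%:Z)) =
  1 - v ^+ (4 * m.+1) - v ^+ (4 * n.+1) + v ^+ (4 * (m + n)).
Proof. by rewrite !exprnP; congr (1 - v ^ _ - v ^ _ + v ^ _); lia. Qed.
End Values.

Lemma vq_sub_neq0 : vq ^ (-2) - vq ^ 2 != 0.
Proof. by rewrite subV_factor ?mulf_neq0 ?expfz_neq0 ?vq_neq1 ?vq_neq0. Qed.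

Lemma Jsharp_qpow (r s : int) b w : word_mx w 0 0 = r -> word_mx w 1 0 = s ->
  Jsharp param_tq w b =
  \sum_(k < b.+1)
    let p : rat := k%:R - b%:R / 2 in
    qpow (- (r%:~R * s%:~R * p ^+ 2))
      / (qpow (- (1 / 2)) - qpow (1 / 2))
      * (qpow ((r%:~R + s%:~R) * p - 1 / 2)
         - qpow ((r%:~R - s%:~R) * p + 1 / 2)).
Proof.
move=> wr ws; have v0 := vq_neq0.
have d0 := vq_sub_neq0.
apply: (mulfI d0); rewrite [LHS](Jsharp_tmac (P := param_tq) _ vq_free) // wr ws.
rewrite /tmac mulr_sumr; apply: eq_bigr => k _ /=.
have -> : qpow (- (1 / 2)) = vq ^ (-2) by apply: qpowE.
have -> : qpow (1 / 2) = vq ^ 2 by apply: qpowE.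
rewrite [RHS]mulrA [X in _ = X * _]mulrCA divff // mulr1.
(* Twice the summation variable p; the exponent of the monomial is - j. *)
pose j : int := 2 * k%:Z - b%:Z.
have pE : k%:R - b%:R / 2 = j%:~R / 2 :> rat.
  by rewrite /j rmorphB rmorphM /= -!pmulrn; field.
rewrite pE (qpowE (n := - (r * s * j ^+ 2))); last by field.
rewrite (qpowE (n := 2 * (r + s) * j - 2)); last by field.
rewrite (qpowE (n := 2 * (r - s) * j + 2)); last by field.
by rewrite (_ : b%:Z - 2 * k%:Z = - j) ?tmono_weyl // opprB.
Qed.

Lemma Jsharp1 (r s : int) w : word_mx w 0 0 = r -> word_mx w 1 0 = s ->
  Jsharp param_tq w 1 = vq ^ (- (r * s) - 2 * (r + s)) / (1 - vq ^ 4)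
    * (1 - vq ^ (4 * (r + 1)) - vq ^ (4 * (s + 1)) + vq ^ (4 * (r + s))).
Proof.
move=> wr ws; have v0 := vq_neq0.
have d0 := vq_sub_neq0.
apply: (mulfI d0); rewrite [LHS](Jsharp_tmac (P := param_tq) _ vq_free) // wr ws.
have v1 : 1 - vq ^ 4 != 0 by apply: vq_neq1.
by rewrite tmac1 (tsym_weyl v0 r s v1).
Qed.

(** Stated in v = q^{1/4}, hence the factors 4 in the exponents.  For odd m the
    factor 1 - q^{m+1} is divisible by 1 - q^2. *)
Lemma lowest_quotient (m n : nat) : coprime m n ->
  exists p : {poly rat}, p`_0 != 0 /\
   p * (1 - 'X ^+ 8) =
    1 - 'X ^+ (4 * m.+1) - 'X ^+ (4 * n.+1) + 'X ^+ (4 * (m + n)).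
Proof.
wlog om : m n / odd m => [W|mn].
  have [om|em] := boolP (odd m); first exact: W.
  have [on|en] := boolP (odd n).
    rewrite coprime_sym => nm; have [p [p0 pE]] := W _ _ on nm.
    by exists p; split=> //; rewrite pE (addnC n) [X in X + _]addrAC.
  move=> mn; have: (2 %| gcdn m n)%N by rewrite dvdn_gcd !dvdn2 em en.
  by rewrite (eqP mn).
pose h := m.+1./2.
have mE : (4 * m.+1 = 8 * h)%N by rewrite /h; lia.
pose p : {poly rat} := (\sum_(i < h) 'X^8 ^+ i) * (1 - 'X^(4 * n.+1)) + 'X^(4 * (m + n)).
have G : (\sum_(i < h) 'X^8 ^+ i) * (1 - 'X^8) = 1 - 'X^(4 * m.+1) :> {poly rat}.
  rewrite mE exprM -[1 in RHS](expr1n _ h) subrXX mulrC; congr (_ * _).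
  by apply: eq_bigr => i _; rewrite expr1n mul1r.
exists p; split.
  rewrite -horner_coef0 /p hornerD hornerM.
  (* Evaluating G at 0 gives the constant term 1 of the geometric sum. *)
  have := congr1 (fun f => f.[0]) G; move: (\sum_(_ < _) _) => f.
  rewrite hornerM !(hornerD, hornerN, hornerXn, hornerC) !expr0n !subr0 !mulr1 => ->.
  by rewrite muln_eq0 addn_eq0; case: (m) om => // m' _; rewrite /= addr0 oner_neq0.
have AB : 'X^(4 * m.+1) * 'X^(4 * n.+1) = 'X^(4 * (m + n)) * 'X^8 :> {poly rat}.
  by rewrite -!exprD; congr ('X^_); lia.
rewrite /p mulrDl mulrAC G mulrBl mul1r !mulrBr !mulr1 AB.
move: 'X^(4 * m.+1) 'X^(4 * n.+1) 'X^(4 * (m + n)) 'X^8 => A B C D; ring.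
Qed.

Lemma lowest_monomial_div (p : {poly rat}) (e : int) (N D : Kq) :
  p`_0 != 0 -> D != 0 -> FracField.tofrac p * D = N ->
  lowest_monomial (vq ^ e * (N / D)) (vq ^ e).
Proof. by move=> p0 D0 <-; exists p, e; rewrite mulfK // mulrC. Qed.

Theorem proposition2p8 (r s : int) (b : nat) (w : seq tau_letter) :
  coprimez r s -> word_mx w 0 0 = r -> word_mx w 1 0 = s ->
  let J := Jsharp param_tq w in
  let reduced : Kq :=
    J 1%N / leval (qpow (- (1 / 2))) (macP 1 (lX Kq) (lXV Kq)) in
  [/\ J b =
        \sum_(k < b.+1)
          let p : rat := k%:R - b%:R / 2 in
          qpow (- (r%:~R * s%:~R * p ^+ 2))
            / (qpow (- (1 / 2)) - qpow (1 / 2))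
            * (qpow ((r%:~R + s%:~R) * p - 1 / 2)
               - qpow ((r%:~R - s%:~R) * p + 1 / 2)),
      J 1%N =
        qpow (- (r%:~R * s%:~R / 4) - (r%:~R + s%:~R) / 2) / (1 - qpow 1)
        * (1 - qpow (r%:~R + 1) - qpow (s%:~R + 1) + qpow (r%:~R + s%:~R))
    & 0 <= r -> 0 <= s ->
      exists m : Kq,
        lowest_monomial reduced m /\
        reduced / m =
          (1 - qpow (r%:~R + 1) - qpow (s%:~R + 1) + qpow (r%:~R + s%:~R))
          / (1 - qpow 2)].
Proof.
move=> rs wr ws J reduced; have v0 := vq_neq0.
have q1 : qpow 1 = vq ^ 4 by apply: qpowE.
have q2 : qpow 2 = vq ^ 8 by apply: qpowE.
have qV : qpow (- (1 / 2)) = vq ^ (-2) by apply: qpowE.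
have qr : qpow (r%:~R + 1) = vq ^ (4 * (r + 1)) by apply: qpowE; field.
have qs : qpow (s%:~R + 1) = vq ^ (4 * (s + 1)) by apply: qpowE; field.
have qrs : qpow (r%:~R + s%:~R) = vq ^ (4 * (r + s)) by apply: qpowE; field.
rewrite qr qs qrs q1 q2.
have E : qpow (- (r%:~R * s%:~R / 4) - (r%:~R + s%:~R) / 2) =
    vq ^ (- (r * s) - 2 * (r + s)) by apply: qpowE; field.
have v8 : 1 - vq ^ 8 != 0 by apply: vq_neq1.
split; first exact: Jsharp_qpow.
  by rewrite E; exact: Jsharp1.
rewrite /reduced /J (Jsharp1 wr ws) qV (leval_macP1 v0).
rewrite (reduce_quotient v0 _ _ v8) => r0 s0.
set m := vq ^ (_ + 2); set N := _ + _; exists m.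
have m0 : m != 0 by exact: (expfz_neq0 _ v0).
split; last by rewrite mulrC mulKf.
have : coprime `|r| `|s| by exact: rs.
case/lowest_quotient => p [p0 pE].
apply: (lowest_monomial_div _ p0 v8).
have := congr1 (@FracField.tofrac _) pE.
rewrite !(tofracD, tofracN, tofracM, tofracXn, tofrac1) -/vq.
by rewrite -(knot_factor_nat v0) !gez0_abs.
Qed.
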